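(* Let $p$ be an odd prime and let $m,\ell$ be positive integers such that $m_\ell=m/(m,\ell)$ is even and $m>6\ell$. Put $\delta=(m,\ell)$, $\varepsilon_\ell=(-1)^{\frac12 m_\ell}$, $n=p^m-1$ and $\mathcal{L}=\langle x^{p^\ell},x^{p^{3\ell}}\rangle\subset\mathbb{F}_{p^m}[x]$. Then $\mathcal{C}_{\mathcal{L},0}$ is an $[n,2m+1,d]_p$-code with $d=p^{m-1}(p-1)-d'$, where $$d'=\begin{cases} p^{\frac m2+3\delta-1}+1 & \text{if }\frac12 m_\ell\text{ is even},\\ (p-1)p^{\frac m2+3\delta-1} & \text{if }\frac12 m_\ell\text{ is odd},\end{cases}$$ and $\mathcal{C}_{\mathcal{L},2}$ is an $[n,3m+1,\hat d]_p$-code with $\hat d=d$ if $\frac12 m_\ell$ is even and $\hat d=d-1$ if $\frac12 m_\ell$ is odd. The weight distributions are as follows (frequencies attached to coinciding weights are to be added), where $F_0,F_1,F_2,F_3$ are the explicit numbers given in the context. (1) $\mathcal{C}_{\mathcal{L},0}$: weight $0$ with frequency $1$; weight $p^m-1$ with frequency $p-1$; and for $i=0,1,2,3$: weight $p^m-p^{m-1}+(-1)^{i+1}\varepsilon_\ell(p-1)p^{\frac m2+i\delta-1}$ with frequency $F_i$; weight $p^m-p^{m-1}+(-1)^{i}\varepsilon_\ell p^{\frac m2+i\delta-1}-1$ with frequency $(p-1)F_i$. (2) $\mathcal{C}_{\mathcal{L},2}$: weight $0$ with frequency $1$; weight $p^m-1$ with frequency $p-1$; weight $p^m-p^{m-1}$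 with frequency $p^m-1+\sum_{i=0}^3F_i(p^m-p^{m-2i\delta})$; weight $p^m-p^{m-1}-1$ with frequency $(p-1)\big(p^m-1+\sum_{i=0}^3F_i(p^m-p^{m-2i\delta})\big)$; and for $i=0,1,2,3$: weight $p^m-p^{m-1}+(-1)^{i+1}\varepsilon_\ell(p-1)p^{\frac m2+i\delta-1}$ with frequency $\big(p^{m-2i\delta-1}+(-1)^i\varepsilon_\ell(p-1)p^{\frac m2-i\delta-1}\big)F_i$; weight $p^m-p^{m-1}+(-1)^{i}\varepsilon_\ell p^{\frac m2+i\delta-1}$ with frequency $\big(p^{m-2i\delta-1}+(-1)^{i+1}\varepsilon_\ell p^{\frac m2-i\delta-1}\big)(p-1)F_i$; weight $p^m-p^{m-1}-1+(-1)^{i+1}\varepsilon_\ell(p-1)p^{\frac m2+i\delta-1}$ with frequency $\big(p^{m-2i\delta-1}+(-1)^{i+1}\varepsilon_\ell p^{\frac m2-i\delta-1}\big)(p-1)F_i$; weight $p^m-p^{m-1}-1+(-1)^{i}\varepsilon_\ell p^{\frac m2+i\delta-1}$ with frequency $\big(p^{m-2i\delta}-p^{m-2i\delta-1}+(-1)^{i}\varepsilon_\ell p^{\frac m2-i\delta-1}\big)(p-1)F_i$.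
   Context: $(m,\ell)$ denotes the greatest common divisor and $\mathrm{Tr}_{p^m/p}$ the trace from $\mathbb{F}_{p^m}$ to $\mathbb{F}_p$. $\mathcal{L}=\{\gamma_1x^{p^\ell}+\gamma_3x^{p^{3\ell}}:\gamma_1,\gamma_3\in\mathbb{F}_{p^m}\}$, and $\mathcal{C}_{\mathcal{L},0}=\{(\mathrm{Tr}_{p^m/p}(xR(x))+b)_{x\in\mathbb{F}_{p^m}^*}:R\in\mathcal{L},\ b\in\mathbb{F}_p\}$, $\mathcal{C}_{\mathcal{L},2}=\{(\mathrm{Tr}_{p^m/p}(xR(x)+\beta x)+b)_{x\in\mathbb{F}_{p^m}^*}:R\in\mathcal{L},\ \beta\in\mathbb{F}_{p^m},\ b\in\mathbb{F}_p\}$. An $[n,k,d]_p$-code is a $k$-dimensional linear code in $\mathbb{F}_p^n$ with minimum Hamming distance $d$. The weight of a codeword is its number of nonzero coordinates; the frequency of a weight is the number of codewords with that weight. With $\Delta=p^{6\delta}+p^{5\delta}-p^{4\delta}+p^{2\delta}-p^{\delta}-1$ and $\Sigma=\sum_{i=0}^{5}(-1)^{i+1}p^{i\delta}$, the numbers $F_i$ are defined by $$\Delta F_0=p^{2m+6\delta}-p^{2m+4\delta}-p^{2m+\delta}+p^{m+4\delta}+p^{m+\delta}-p^{6\delta}+\varepsilon_\ell\big(p^{\frac{3m}2+5\delta}-p^{\frac{3m}2+4\delta}-p^{\frac m2+5\delta}+p^{\frac m2+4\delta}\big),$$ $$\Delta F_1=p^{2m-2\delta}(p^{7\delta}-p^{2\delta}-1)+p^{m-2\delta}(p^{5\delta}-p^{6\delta}+p^{2\delta}+1)-p^{3\delta}(p^{2\delta}-p^{\delta}+1)-\varepsilon_\ell\big(p^{\frac{3m}2}-p^{\frac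 m2}\big)\Sigma,$$ $$\Delta F_2=p^{2m-3\delta}(p^{5\delta}+p^{\delta}-1)-p^{m-3\delta}(p^{6\delta}+p^{4\delta}+p^{\delta}-1)+p^{\delta}(p^{2\delta}-p^{\delta}+1)+\varepsilon_\ell\big(p^{\frac{3m}2-2\delta}-p^{\frac m2-2\delta}\big)\Sigma,$$ $$\Delta F_3=p^{2m-3\delta}-p^m-p^{m-3\delta}+1-\varepsilon_\ell\big(p^{\frac{3m}2-\delta}-p^{\frac{3m}2-2\delta}-p^{\frac m2-\delta}+p^{\frac m2-2\delta}\big).$$ *)

(* Defs.v *)
From mathcomp Require Import all_boot all_order all_algebra all_fingroup all_field.

Set Implicit Arguments.
Unset Strict Implicit.
Unset Printing Implicit Defensive.

Import Order.TTheory GRing.Theory Num.Theory.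
Local Open Scope ring_scope.

Definition hdist (K : finFieldType) (I : finType) (c c' : {ffun I -> K^o}) : nat :=
  #|[set i | c i != c' i]|.

Definition hweight (K : finFieldType) (I : finType) (c : {ffun I -> K^o}) : nat :=
  #|[set i | c i != 0]|.

Definition min_distance (K : finFieldType) (I : finType)
    (C : {set {ffun I -> K^o}}) (d : nat) : Prop :=
  (exists c c', [/\ c \in C, c' \in C, c != c' & hdist c c' = d]) /\
  (forall c c', c \in C -> c' \in C -> c != c' -> (d <= hdist c c')%N).

(* [n, k, d]-codes over K, with coordinates labelled by the finite type I
   instead of 0, ..., n - 1. *)
Definition is_code (K : finFieldType) (I : finType) (n k d : nat)
    (C : {set {ffun I -> K^o}}) : Prop :=
  [/\ #|I| = n,
      exists2 V : {vspace {ffun I -> K^o}}, C =i V & \dim V = k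
    & min_distance C d].

(* The table T lists pairs (weight, frequency); the frequencies of entries with
   the same weight add up, and weights not in the table do not occur. *)
Definition weight_distribution (K : finFieldType) (I : finType)
    (C : {set {ffun I -> K^o}}) (T : seq (rat * rat)) : Prop :=
  forall w : rat,
    #|[set c in C | (hweight c)%:R == w]|%:R = \sum_(t <- T | t.1 == w) t.2.

(* The element of 'F_p whose image in the prime subfield of F is the sum of the
   x ^ (p ^ i); it exists when #|F| = p ^ m by abs_traceE, and the value is 0 by
   convention otherwise. *)
Definition abs_trace (p m : nat) (F : finFieldType) (x : F) : 'F_p :=
  odflt 0 [pick c : 'F_p | (c : nat)%:R == \sum_(i < m) x ^+ (p ^ i)].

Lemma abs_traceE (p m : nat) (F : finFieldType) (x : F) :
  prime p -> #|F| = (p ^ m)%N ->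
  (abs_trace p m x : nat)%:R = \sum_(i < m) x ^+ (p ^ i).
Proof.
move=> p_pr cardF; have chF := card_finPcharP cardF p_pr.
rewrite /abs_trace; case: pickP => [c /eqP //|noc].
set s := \sum_(i < m) _ in noc *.
have sp : s ^+ p = s.
  have -> : s ^+ p = \sum_(i < m) x ^+ (p ^ i.+1).
    rewrite -(pFrobenius_autE chF) /s rmorph_sum; apply: eq_bigr => i _ /=.
    by rewrite pFrobenius_autE expnSr exprM.
  rewrite /s; case: (m) cardF => [|k] cardF; first by rewrite !big_ord0.
  rewrite big_ord_recr [RHS]big_ord_recl /= addrC expn0 expr1 -cardF expf_card.
  by congr (_ + _); apply: eq_bigr => i _; rewrite /bump.
pose S := [seq ((c : 'F_p) : nat)%:R : F | c <- enum 'F_p].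
have val_lt (c : 'F_p) : (c < p)%N by rewrite -[X in (_ < X)%N](Fp_cast p_pr).
have S_uniq : uniq S.
  rewrite map_inj_uniq ?enum_uniq // => a b eq_ab.
  apply/val_inj; wlog le_ab : a b eq_ab / (a <= b)%N => [hw|].
    by case/orP: (leq_total a b) => /hw -> //.
  have : (p %| b - a)%N.
    by rewrite (dvdn_pcharf chF) natrB // eq_ab subrr.
  rewrite /dvdn modn_small; last by apply: leq_ltn_trans (leq_subr _ _) (val_lt b).
  by rewrite subn_eq0 => le_ba; apply/eqP; rewrite eqn_leq le_ab.
have sizeP : size ('X^p - 'X : {poly F}) = p.+1.
  by rewrite size_polyDl ?size_polyXn // size_polyN size_polyX ltnS prime_gt1.
have P0 : 'X^p - 'X != 0 :> {poly F} by rewrite -size_poly_eq0 sizeP.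
have sNS : s \notin S.
  by apply/mapP => -[c _ sc]; move: (noc c); rewrite sc eqxx.
have rootS : all (root ('X^p - 'X)) (s :: S).
  rewrite /= /root !hornerE ?hornerXn sp subrr eqxx /=.
  apply/allP => _ /mapP[c _ ->]; rewrite /root !hornerE ?hornerXn subr_eq0.
  by rewrite -(pFrobenius_autE chF) rmorph_nat.
have := max_poly_roots P0 rootS; rewrite /= sNS S_uniq sizeP => /(_ isT).
by rewrite size_map -cardE card_Fp // ltnn.
Qed.

(* (Tr(f(x)) + b) for x in F \ {0}. *)
Definition trace_word (p m : nat) (F : finFieldType) (f : {poly F}) (b : 'F_p) :
    {ffun {x : F | x != 0} -> ('F_p)^o} :=
  [ffun x => abs_trace p m f.[val x] + b].

Definition Lpoly (p l : nat) (F : finFieldType) (g : F * F) : {poly F} :=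
  g.1 *: 'X^(p ^ l) + g.2 *: 'X^(p ^ (3 * l)).

Definition code_L0 (p m l : nat) (F : finFieldType) :
    {set {ffun {x : F | x != 0} -> ('F_p)^o}} :=
  [set trace_word m ('X * Lpoly p l g) b | g : F * F, b : 'F_p].

Definition code_L2 (p m l : nat) (F : finFieldType) :
    {set {ffun {x : F | x != 0} -> ('F_p)^o}} :=
  [set trace_word m ('X * Lpoly p l h.1 + h.2 *: 'X) b
     | h : (F * F) * F, b : 'F_p].

(* In everything below, m is even and m > 6 * l, so that the halves are exact and
   no subtraction of natural numbers is truncated. *)

Definition eps (m l : nat) : rat := (-1) ^+ (m %/ gcdn m l)./2.

Definition dmin_L0 (p m l : nat) : nat :=
  let e := (m./2 + 3 * gcdn m l - 1)%N in
  let d' := if odd (m %/ gcdn m l)./2 then ((p - 1) * p ^ e)%N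
            else (p ^ e + 1)%N in
  (p ^ (m - 1) * (p - 1) - d')%N.

Definition dmin_L2 (p m l : nat) : nat :=
  if odd (m %/ gcdn m l)./2 then (dmin_L0 p m l - 1)%N else dmin_L0 p m l.

Definition Delta (p m l : nat) : rat :=
  let d := gcdn m l in
  let P k : rat := p%:R ^+ k in
  P (6 * d)%N + P (5 * d)%N - P (4 * d)%N + P (2 * d)%N - P d - 1.

Definition Sigma (p m l : nat) : rat :=
  \sum_(i < 6) (-1) ^+ i.+1 * p%:R ^+ (i * gcdn m l).

Definition DeltaF (p m l i : nat) : rat :=
  let d := gcdn m l in
  let h := m./2 in
  let e := eps m l in
  let S := Sigma p m l in
  let P k : rat := p%:R ^+ k in
  match i with
  | 0 => P (2 * m + 6 * d)%N - P (2 * m + 4 * d)%N - P (2 * m + d)%N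
         + P (m + 4 * d)%N + P (m + d)%N - P (6 * d)%N
         + e * (P (3 * h + 5 * d)%N - P (3 * h + 4 * d)%N
                - P (h + 5 * d)%N + P (h + 4 * d)%N)
  | 1 => P (2 * m - 2 * d)%N * (P (7 * d)%N - P (2 * d)%N - 1)
         + P (m - 2 * d)%N * (P (5 * d)%N - P (6 * d)%N + P (2 * d)%N + 1)
         - P (3 * d)%N * (P (2 * d)%N - P d + 1)
         - e * (P (3 * h)%N - P h) * S
  | 2 => P (2 * m - 3 * d)%N * (P (5 * d)%N + P d - 1)
         - P (m - 3 * d)%N * (P (6 * d)%N + P (4 * d)%N + P d - 1)
         + P d * (P (2 * d)%N - P d + 1)
         + e * (P (3 * h - 2 * d)%N - P (h - 2 * d)%N) * S
  | 3 => P (2 * m - 3 * d)%N - P m - P (m - 3 * d)%N + 1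
         - e * (P (3 * h - d)%N - P (3 * h - 2 * d)%N
                - P (h - d)%N + P (h - 2 * d)%N)
  | _ => 0
  end.

Definition Freq (p m l i : nat) : rat := DeltaF p m l i / Delta p m l.

Definition table_L0 (p m l : nat) : seq (rat * rat) :=
  let d := gcdn m l in
  let h := m./2 in
  let e := eps m l in
  let F := Freq p m l in
  let P k : rat := p%:R ^+ k in
  let q : rat := p%:R - 1 in
  [:: (0, 1); (P m - 1, q)] ++
  flatten [seq
    [:: (P m - P (m - 1)%N + (-1) ^+ i.+1 * e * q * P (h + i * d - 1)%N, F i);
        (P m - P (m - 1)%N + (-1) ^+ i * e * P (h + i * d - 1)%N - 1, q * F i)]
    | i <- iota 0 4].

Definition table_L2 (p m l : nat) : seq (rat * rat) :=
  let d := gcdn m l in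
  let h := m./2 in
  let e := eps m l in
  let F := Freq p m l in
  let P k : rat := p%:R ^+ k in
  let q : rat := p%:R - 1 in
  let N := P m - 1 + \sum_(i < 4) F i * (P m - P (m - 2 * i * d)%N) in
  [:: (0, 1); (P m - 1, q);
      (P m - P (m - 1)%N, N);
      (P m - P (m - 1)%N - 1, q * N)] ++
  flatten [seq
    [:: (P m - P (m - 1)%N + (-1) ^+ i.+1 * e * q * P (h + i * d - 1)%N,
         (P (m - 2 * i * d - 1)%N + (-1) ^+ i * e * q * P (h - i * d - 1)%N)
           * F i);
        (P m - P (m - 1)%N + (-1) ^+ i * e * P (h + i * d - 1)%N,
         (P (m - 2 * i * d - 1)%N + (-1) ^+ i.+1 * e * P (h - i * d - 1)%N)
           * q * F i);
        (P m - P (m - 1)%N - 1 + (-1) ^+ i.+1 * e * q * P (h + i * d - 1)%N,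
         (P (m - 2 * i * d - 1)%N + (-1) ^+ i.+1 * e * P (h - i * d - 1)%N)
           * q * F i);
        (P m - P (m - 1)%N - 1 + (-1) ^+ i * e * P (h + i * d - 1)%N,
         (P (m - 2 * i * d)%N - P (m - 2 * i * d - 1)%N
          + (-1) ^+ i * e * P (h - i * d - 1)%N) * q * F i)]
    | i <- iota 0 4].

(* Main.v *)
Require Import Defs.
From mathcomp Require Import all_boot all_order all_algebra all_fingroup all_field.
From mathcomp Require Import cyclic zify ring lra.

Set Implicit Arguments.
Unset Strict Implicit.
Unset Printing Implicit Defensive.

Import Order.TTheory GRing.Theory Num.Theory.
Local Open Scope ring_scope.

(** Write [q = p ^ d] with [d = gcdn m l], [n = m / (2 * d)], and [s] for the Frobenius
    map [x ^+ p ^ l].  Since [m / d] is even, [l / d] is odd; so [s] fixes the subfield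
    of order [q], and it acts as the conjugation [x ^+ q] on the subfield [K] of order
    [q ^ 2], which is contained in [F] as well.

    For [g = (g1, g3)] the words of the first code come from the quadratic form
    [Q_g x = Tr (g1 * x ^+ (p ^ l).+1 + g3 * x ^+ (p ^ (3 * l)).+1)].  If [c] is in [K],
    then [Q_g (c * x)] is obtained by multiplying the argument of the trace by the norm
    [c ^+ q.+1]: the form is Hermitian over [K].  This has three consequences.
    - Every nonzero element of the prime field is a norm, so all nonzero values of [Q_g]
      are equally frequent, and the exponential sum [S_g] of the form is an integer
      which determines the whole value distribution ([qform_fibre_const]).
    - The radical is a vector space over [K].  It consists of roots of a linearized
      polynomial of degree [6] in [s], hence for nonzero [g] it has [q ^ (2 * i)]
      elements with [i < 4] ([card_linearized_roots], [card_radical]).  As usual [S_g ^ 2]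
      is [p ^ m] times the order of the radical ([expsum_sqr]).
    - The [q + 1] elements of norm [1] act freely on the nonzero vectors and preserve
      [Q_g], so [S_g] is [1] modulo [q + 1].  As [q] is [-1] modulo [q + 1], this gives
      the sign: [S_g = (-1) ^ (n + i) * q ^ (n + i)] ([expsum_radical]).

    Let [A_i] be the number of nonzero [g] of corank [i].  By orthogonality of
    characters, the sum over [g] of [S_g ^ k] counts the vectors of [F ^ k] on which both
    [x ^+ (p ^ l).+1] and [x ^+ (p ^ (3 * l)).+1] sum to [0].  For [k = 3] such a vector
    [v] makes [v] and [s^2 v] orthogonal to [s v] and [s^3 v]; in dimension [3] this
    forces [s^2 v] to be proportional to [v], so that [v] is a multiple of an isotropic
    vector of the Hermitian plane over [K] ([isotropic_in_subfield],
    [card_triple_zeros]).  The moments for [k = 0, 1, 2, 3] form a Vandermonde system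
    with nodes [(- q) ^ i], whose solution is [A_i = F_i] ([Freq_corank]).

    In the second code a term [Tr (b * x)] is added.  When [b] is in the image of the
    polarisation, completing the square reduces the fibres to those of [Q_g], and each
    such [b] arises from as many translations as the radical has elements; all other
    [b] give equidistributed values ([affine_fibre_polar], [affine_fibre_balanced]).
    Summing over [b] and over the constants gives the weights of all words with a given
    [g] ([L0_weight_sum], [L2_weight_sum]), hence the two tables.  All nonzero parameters
    give words of positive weight, so the parameters count the codewords, and the
    minimum distances are read off from the largest possible fibre, which occurs at
    corank [3] ([exists_min_word]). *)

(** * Roots of unity and powers in a finite field *)

Lemma finField_prim_root (F : finFieldType) :
  exists z : F, (#|F|.-1).-primitive_root z.
Proof.
have N_gt0 : (0 < #|F|.-1)%N by rewrite -subn1 subn_gt0 finNzRing_gt1.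
pose rs := enum [set~ (0 : F)].
have /hasP[z _ z_prim] : has (#|F|.-1).-primitive_root rs.
  apply: has_prim_root => //; last 2 first.
  - exact: enum_uniq.
  - by rewrite -cardE cardsC1.
  apply/allP => x; rewrite mem_enum !inE unity_rootE => x_neq0.
  rewrite -(inj_eq (mulfI x_neq0)) -exprS mulr1 prednK ?expf_card //.
  exact: ltnW (finNzRing_gt1 F).
by exists z.
Qed.

Lemma exists_root_of_power (F : finFieldType) (n k : nat) (c : F) :
  (n * k %| #|F|.-1)%N -> (0 < n * k)%N -> c ^+ k = 1 -> exists x : F, x ^+ n = c.
Proof.
move=> dvd_nk nk_gt0 ck1; have [z z_prim] := finField_prim_root F.
have w_prim := dvdn_prim_root z_prim dvd_nk.
have := dvdn_prim_root w_prim (dvdn_mull n (dvdnn k)).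
rewrite mulnK; last by case: (k) nk_gt0; rewrite ?muln0.
move=> wn_prim; have [i ->] := prim_rootP wn_prim ck1.
by exists (z ^+ (#|F|.-1 %/ (n * k)) ^+ i); rewrite exprAC.
Qed.

Lemma card_unity_roots (F : finFieldType) (n : nat) :
  (n %| #|F|.-1)%N -> (0 < n)%N -> #|[set x : F | x ^+ n == 1]| = n.
Proof.
move=> dvd_n n_gt0; have [z z_prim] := finField_prim_root F.
have w_prim := dvdn_prim_root z_prim dvd_n; set w := z ^+ _ in w_prim.
have inj_w : injective (fun i : 'I_n => w ^+ i).
  move=> i j /eqP; rewrite (eq_prim_root_expr w_prim).
  by rewrite !modn_small // => /eqP/val_inj.
rewrite -[RHS]card_ord -(card_imset predT inj_w).
apply: eq_card => x; rewrite inE; apply/eqP/imsetP => [x1|[i _ ->]].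
  by have [i ->] := prim_rootP w_prim x1; exists i.
by rewrite exprAC (prim_expr_order w_prim) expr1n.
Qed.

Lemma card_power_fibre (F : finFieldType) (n k : nat) (c : F) :
  (n * k %| #|F|.-1)%N -> (0 < n * k)%N -> c ^+ k = 1 ->
  #|[set x : F | x ^+ n == c]| = n.
Proof.
move=> dvd_nk nk_gt0 ck1; have [x0 x0n] := exists_root_of_power dvd_nk nk_gt0 ck1.
have n_gt0 : (0 < n)%N by case: (n) nk_gt0.
have k_gt0 : (0 < k)%N by case: (k) nk_gt0; rewrite ?muln0.
have x0_neq0 : x0 != 0.
  apply/eqP => x00; move: ck1; rewrite -x0n x00 expr0n gtn_eqF //= expr0n gtn_eqF //.
  by move/eqP; rewrite eq_sym oner_eq0.
rewrite -[RHS](card_unity_roots (dvdn_trans (dvdn_mulr k (dvdnn n)) dvd_nk)) //.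
rewrite -[RHS](card_imset _ (mulfI x0_neq0)); apply: eq_card => x.
rewrite [LHS]inE; apply/eqP/imsetP => [xn|[y]].
  exists (x / x0); last by rewrite mulrC divfK.
  by rewrite inE expr_div_n xn x0n divff // -x0n expf_neq0.
by rewrite inE => /eqP yn ->; rewrite exprMn yn x0n mulr1.
Qed.

(** The roots of unity act freely on the nonzero elements, and the orbits are
    the fibres of the power map. *)
Lemma dvdn_card_unity_stable (F : finFieldType) (n : nat) (A : {set F}) :
  (n %| #|F|.-1)%N -> (0 < n)%N -> 0 \notin A ->
  (forall x z, x \in A -> z ^+ n = 1 -> z * x \in A) -> (n %| #|A|)%N.
Proof.
move=> dvd_n n_gt0 A0 stabA.
rewrite -sum1_card (partition_big_imset (fun x => x ^+ n)).
apply: dvdn_sum => y /imsetP[x xA ->]; rewrite sum1dep_card.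
have x_neq0 : x != 0 by apply: contraNneq A0 => <-.
suff -> : #|[set u in A | u ^+ n == x ^+ n]| = n by [].
rewrite -[RHS](card_unity_roots dvd_n) // -[RHS](card_imset _ (mulIf x_neq0)).
apply: eq_card => u; rewrite [LHS]inE; apply/andP/imsetP => [[uA /eqP ux]|[z]].
  exists (u / x); last by rewrite divfK.
  by rewrite inE expr_div_n ux divff // expf_neq0.
rewrite inE => /eqP zn ->; split; first exact: stabA.
by rewrite exprMn zn mul1r.
Qed.

(** Reducing [b] modulo [a] leaves [p ^ (b %% a) - 1], which is smaller than the
    divisor. *)
Lemma dvdn_pred_exp (p a b : nat) :
  (1 < p)%N -> ((p ^ a).-1 %| (p ^ b).-1)%N -> (a %| b)%N.
Proof.
move=> p_gt1; have p_gt0 := ltnW p_gt1.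
case: a => [|a].
  by rewrite expn0 /= dvd0n -subn1 subn_eq0 -(expn0 p) leq_exp2l // leqn0 => /eqP->.
rewrite {1}(divn_eq b a.+1) expnD => dvd_ab.
set r := (b %% a.+1)%N in dvd_ab.
have r_lt : (r < a.+1)%N by rewrite ltn_mod.
have dvd_q : ((p ^ a.+1).-1 %| (p ^ (b %/ a.+1 * a.+1)).-1)%N.
  by rewrite mulnC expnM dvdn_pred_predX.
have eqPr : (p ^ (b %/ a.+1 * a.+1) * p ^ r).-1
     = ((p ^ (b %/ a.+1 * a.+1)).-1 * p ^ r + (p ^ r).-1)%N.
  have := expn_gt0 p (b %/ a.+1 * a.+1); have := expn_gt0 p r; rewrite p_gt0 /=.
  case: (p ^ r)%N => // u _; case: (p ^ _)%N => // v _.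
  by rewrite mulSn addSn [LHS]/= addnC.
rewrite eqPr dvdn_addr in dvd_ab; last exact: dvdn_mulr.
have : (p ^ r < p ^ a.+1)%N by rewrite ltn_exp2l.
move=> lt_r; suff r0 : r = 0 by rewrite /dvdn -/r r0.
have pr0 : (p ^ r).-1 = 0%N.
  apply/eqP; apply: contraTT dvd_ab; rewrite -lt0n => pr_gt0.
  rewrite gtnNdvd // -ltnS !prednK ?expn_gt0 ?p_gt0 //.
apply/eqP; rewrite -leqn0 -(leq_exp2l _ _ p_gt1) expn0.
by rewrite -subn_eq0 subn1 pr0.
Qed.

Lemma frobenius_fixed_gcd (F : fieldType) (p a b : nat) (x : F) :
  (0 < a)%N -> x ^+ (p ^ a) = x -> x ^+ (p ^ b) = x -> x ^+ (p ^ gcdn a b) = x.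
Proof.
move=> a_gt0 xa xb.
have fixM c k : x ^+ (p ^ c) = x -> x ^+ (p ^ (k * c)) = x.
  by move=> xc; elim: k => [|k IH]; rewrite ?expr1 // mulSn expnD exprM xc.
have [km kn def_gcd _] := egcdnP b a_gt0.
have := fixM a km xa; rewrite def_gcd addnC expnD exprM => {2}<-.
suff /(_ (kn * b)%N (fixM b kn xb)) : forall k, x ^+ (p ^ k) = x ->
  (x ^+ (p ^ gcdn a b)) ^+ (p ^ k) = x ^+ (p ^ gcdn a b) by move=> ->.
by move=> k xk; rewrite exprAC xk.
Qed.

Lemma card_frobenius_fixed (F : finFieldType) (p m d : nat) :
  prime p -> #|F| = (p ^ m)%N -> (d %| m)%N -> (0 < d)%N ->
  #|[set x : F | x ^+ (p ^ d) == x]| = (p ^ d)%N.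
Proof.
move=> p_pr cardF /dvdnP[k def_m] d_gt0.
have pd_gt1 : (1 < p ^ d)%N by rewrite -(exp1n d) ltn_exp2r ?prime_gt1.
have pd_gt0 := ltnW pd_gt1.
rewrite (cardsD1 0) inE expr0n gtn_eqF // eqxx.
suff -> : [set x : F | x ^+ (p ^ d) == x] :\ 0 = [set x | x ^+ (p ^ d).-1 == 1].
  rewrite card_unity_roots ?add1n ?prednK // -?subn1 ?subn_gt0 // !subn1.
  by rewrite cardF def_m mulnC expnM dvdn_pred_predX.
apply/setP => x; rewrite !inE; have [->|x_neq0] := eqVneq x 0.
  by rewrite !expr0n !gtn_eqF ?eqxx // -?subn1 ?subn_gt0 // eq_sym oner_eq0.
by rewrite -{1}(prednK pd_gt0) exprS -[X in _ == X]mulr1 (inj_eq (mulfI x_neq0)).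
Qed.

(** * Linearized polynomials *)

Lemma frobeniusD (F : fieldType) (p k : nat) (x y : F) :
  p \in [pchar F] -> (x + y) ^+ (p ^ k) = x ^+ (p ^ k) + y ^+ (p ^ k).
Proof.
by move=> chF; rewrite exprDn_pchar // pnatX pnatE ?(pcharf_prime chF) // chF.
Qed.

Lemma frobeniusN (F : fieldType) (p k : nat) (x : F) :
  p \in [pchar F] -> (- x) ^+ (p ^ k) = - x ^+ (p ^ k).
Proof.
move=> chF; apply/eqP; rewrite -addr_eq0 -frobeniusD // addNr expr0n.
by rewrite gtn_eqF // expn_gt0 prime_gt0 ?(pcharf_prime chF).
Qed.

Lemma frobeniusB (F : fieldType) (p k : nat) (x y : F) :
  p \in [pchar F] -> (x - y) ^+ (p ^ k) = x ^+ (p ^ k) - y ^+ (p ^ k).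
Proof. by move=> chF; rewrite frobeniusD // frobeniusN. Qed.

Lemma frobenius_inj (F : fieldType) (p k : nat) :
  p \in [pchar F] -> injective (fun x : F => x ^+ (p ^ k)).
Proof.
move=> chF x y /= /eqP; rewrite -subr_eq0 -frobeniusB // expf_eq0 subr_eq0.
by case/andP => _ /eqP.
Qed.

(** Abel summation: when the coefficients [g] sum to [0], a combination of the
    [Y i] is a combination of their consecutive differences. *)
Lemma sum_by_parts (R : pzRingType) (k : nat) (g Y : nat -> R) :
  \sum_(i < k.+2) g i = 0 ->
  \sum_(i < k.+2) g i * Y i =
  \sum_(i < k.+1) (\sum_(i.+1 <= j < k.+2) g j) * (Y i.+1 - Y i).
Proof.
move=> sum_g; pose B i := \sum_(i <= j < k.+2) g j.
have gE (i : 'I_k.+2) : g i = B i - B i.+1 by rewrite /B big_ltn // addrK.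
rewrite (eq_bigr (fun i : 'I_k.+2 => B i * Y i - B i.+1 * Y i)); last first.
  by move=> i _; rewrite gE mulrBl.
have [B0 Bk] : B 0%N = 0 /\ B k.+2 = 0 by rewrite /B big_mkord big_geq.
rewrite sumrB big_ord_recl [X in _ - X]big_ord_recr /= B0 Bk !mul0r add0r addr0.
rewrite -sumrB.
by apply: eq_bigr => i _; rewrite mulrBr.
Qed.

(** A nonzero linearized polynomial of degree [k] in the Frobenius map
    [x ^+ (p ^ l)] has at most [e ^ k] roots, [e] being the number of fixed
    points of that map.  A nonzero root can be moved to [1] by a homothety; then
    the polynomial factors on the right through [x ^+ (p ^ l) - x], whose fibres
    have [e] elements, and the cofactor has degree [k - 1]. *)
Lemma card_linearized_roots (F : finFieldType) (p l k : nat) (a : nat -> F) :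
  p \in [pchar F] -> (exists2 i, (i <= k)%N & a i != 0) ->
  (#|[set x : F | (\sum_(i < k.+1) a i * x ^+ (p ^ (l * i)) == 0)%R]|
     <= #|[set x : F | x ^+ (p ^ l) == x]| ^ k)%N.
Proof.
move=> chF; set e := #|[set x : F | x ^+ (p ^ l) == x]|.
have p_gt0 : (0 < p)%N by rewrite prime_gt0 ?(pcharf_prime chF).
have e_gt0 : (0 < e)%N by apply/card_gt0P; exists 1; rewrite inE expr1n.
elim: k a => [|k IHk] a [i le_ik ai].
  move: le_ik ai; rewrite leqn0 => /eqP -> a0.
  rewrite expn0 -[X in (_ <= X)%N](cards1 (0 : F)).
  apply/subset_leq_card/subsetP => x; rewrite !inE. rewrite big_ord1 muln0 expn0 expr1.
  by rewrite mulf_eq0 (negPf a0).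
set f := fun x => \sum_(i < k.+2) a i * x ^+ (p ^ (l * i)).
case: (pickP (fun x => (x != 0) && (f x == 0))) => [x0 /andP[x0_neq0 /eqP fx0]|no_root];
  last first.
  have e_pow : (1 <= e ^ k.+1)%N by rewrite expn_gt0 e_gt0.
  apply: leq_trans e_pow; rewrite -[X in (_ <= X)%N](cards1 (0 : F)).
  apply/subset_leq_card/subsetP => x; rewrite !inE => fx.
  by have := no_root x; rewrite [f x]/f fx andbT => /negbFE.
pose g i := a i * x0 ^+ (p ^ (l * i)).
pose b i := \sum_(i.+1 <= j < k.+2) g j.
have sum_g : \sum_(i < k.+2) g i = 0 by [].
have b_neq0 : exists2 i, (i <= k)%N & b i != 0.
  suff /existsP[j bj] : [exists j : 'I_k.+1, b j != 0] by exists j => //; rewrite -ltnS.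
  apply: contraNT ai => /existsPn b0.
  have B0 j : (j <= k.+2)%N -> \sum_(j <= u < k.+2) g u = 0.
    case: j => [|j]; first by rewrite big_mkord.
    rewrite ltnS leq_eqVlt => /orP[/eqP->|lt_j]; first by rewrite big_geq.
    by have /negbNE/eqP := b0 (Ordinal lt_j).
  have : g i = 0.
    have := B0 i (leqW le_ik); rewrite big_ltn // B0 //; first by rewrite addr0.
  by move/eqP; rewrite mulf_eq0 expf_eq0 (negPf x0_neq0) andbF orbF.
pose h z := \sum_(i < k.+1) b i * z ^+ (p ^ (l * i)).
pose D (y : F) := y ^+ (p ^ l) - y.
have fE y : f (x0 * y) = h (D y).
  transitivity (\sum_(i < k.+2) g i * y ^+ (p ^ (l * i))).
    by apply: eq_bigr => j _; rewrite exprMn mulrA.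
  rewrite (sum_by_parts (fun i => y ^+ (p ^ (l * i)))) //.
  apply: eq_bigr => j _; congr (_ * _).
  by rewrite frobeniusB // -exprM -expnD -mulnS.
have card_fibre (y : F) : (#|[set u | D u == D y]| <= e)%N.
  rewrite -(card_imset _ (addIr (- y))).
  apply/subset_leq_card/subsetP => u /imsetP[v]; rewrite inE => /eqP Dv ->.
  rewrite inE frobeniusB // -subr_eq0.
  suff -> : v ^+ (p ^ l) - y ^+ (p ^ l) - (v - y) = D v - D y by rewrite Dv subrr.
  by rewrite /D !opprD !opprK addrACA.
rewrite -[X in (X <= _)%N](card_imset _ (mulfI (invr_neq0 x0_neq0))) expnSr.
set A := imset _ _; rewrite -[#|A|]sum1_card (partition_big_imset D).
apply: (@leq_trans (#|D @: A| * e)).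
  rewrite -sum_nat_const; apply: leq_sum => _ /imsetP[y _ ->].
  rewrite sum1dep_card; apply: leq_trans (card_fibre y).
  by apply/subset_leq_card/subsetP => u; rewrite !inE => /andP[].
rewrite leq_pmul2r //; apply: leq_trans (IHk b b_neq0).
apply/subset_leq_card/subsetP => _ /imsetP[y /imsetP[x fx ->] ->].
by move: fx; rewrite !inE -/(h _) -fE mulVKf.
Qed.

(** * The absolute trace *)

Section PrimeSubfield.
Variables (p : nat) (F : fieldType).
Hypothesis chF : p \in [pchar F].
Let p_pr := pcharf_prime chF.

Lemma Fp_natrD (c e : 'F_p) : ((c + e)%R : nat)%:R = (c : nat)%:R + (e : nat)%:R :> F.
Proof.
rewrite -natrD -(GRing.natr_mod_pchar chF (c + e)) /=.
by congr (_ %% _)%:R; apply: Fp_cast.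
Qed.

Lemma Fp_natrM (c e : 'F_p) : ((c * e)%R : nat)%:R = (c : nat)%:R * (e : nat)%:R :> F.
Proof.
rewrite -natrM -(GRing.natr_mod_pchar chF (c * e)) /=.
by congr (_ %% _)%:R; apply: Fp_cast.
Qed.

Lemma Fp_natr_eq0 (c : 'F_p) : ((c : nat)%:R == 0 :> F) = (c == 0).
Proof.
rewrite -(dvdn_pcharf chF); apply/idP/eqP => [|->]; last exact: dvdn0.
have c_lt : (c < p)%N by rewrite -[X in (_ < X)%N](Fp_cast p_pr).
rewrite /dvdn modn_small // => /eqP c0; exact/val_inj.
Qed.

Lemma Fp_natrN1 : (((-1)%R : 'F_p) : nat)%:R = -1 :> F.
Proof.
have one : ((1%R : 'F_p) : nat)%:R = 1 :> F.
  have nz : ((1%R : 'F_p) : nat)%:R != 0 :> F by rewrite Fp_natr_eq0 oner_eq0.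
  by apply: (mulfI nz); rewrite -Fp_natrM !mulr1.
by apply/eqP; rewrite -addr_eq0 -{2}one -Fp_natrD addNr.
Qed.

Lemma Fp_natr_inj : injective (fun c : 'F_p => (c : nat)%:R : F).
Proof.
move=> c e /= eq_ce; apply/eqP; rewrite -subr_eq0 -Fp_natr_eq0.
rewrite -[X in X == 0](addrK (e : nat)%:R) -Fp_natrD subrK eq_ce subrr //.
Qed.

Lemma Fp_natr_frobenius (c : 'F_p) k : ((c : nat)%:R : F) ^+ (p ^ k) = (c : nat)%:R.
Proof.
elim: k => [|k IHk]; first by rewrite expn0 expr1.
by rewrite expnSr exprM IHk -(pFrobenius_autE chF) rmorph_nat.
Qed.

End PrimeSubfield.

Section Trace.
Variables (p m : nat) (F : finFieldType).
Hypotheses (p_pr : prime p) (cardF : #|F| = (p ^ m)%N).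
Let chF : p \in [pchar F] := card_finPcharP cardF p_pr.
Local Notation Tr := (@abs_trace p m F).

Lemma abs_traceD x y : Tr (x + y) = Tr x + Tr y.
Proof.
apply: (Fp_natr_inj chF); rewrite Fp_natrD // !abs_traceE // -big_split /=.
by apply: eq_bigr => i _; rewrite frobeniusD.
Qed.

Lemma abs_traceZ (c : 'F_p) x : Tr ((c : nat)%:R * x) = c * Tr x.
Proof.
apply: (Fp_natr_inj chF); rewrite Fp_natrM // !abs_traceE // mulr_sumr.
by apply: eq_bigr => i _; rewrite exprMn Fp_natr_frobenius.
Qed.

Lemma abs_trace0 : Tr 0 = 0.
Proof. by apply: (addrI (Tr 0)); rewrite -abs_traceD !addr0. Qed.

Lemma abs_trace_frobenius k x : Tr (x ^+ (p ^ k)) = Tr x.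
Proof.
elim: k => [|k IHk]; first by rewrite expn0 expr1.
rewrite -IHk; set y := x ^+ (p ^ k); rewrite expnSr exprM -/y.
apply: (Fp_natr_inj chF); rewrite !abs_traceE //.
have cardF' := cardF; case: m cardF' => [|n] cardF'; first by rewrite !big_ord0.
rewrite big_ord_recr [RHS]big_ord_recl /= addrC.
congr (_ + _); last by apply: eq_bigr => i _; rewrite -exprM -expnS.
by rewrite -exprM -expnS -cardF' expf_card expr1.
Qed.

Lemma card_field_exp_gt0 : (0 < m)%N.
Proof.
rewrite lt0n; apply: contraTneq (finNzRing_gt1 F) => m0.
by rewrite cardF m0.
Qed.

(** The trace is a linearized polynomial of degree [m - 1] in the Frobenius map, so it
    has at most [p ^ (m - 1)] roots. *)
Lemma abs_trace_nontrivial : exists x, Tr x != 0.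
Proof.
apply/existsP; apply: contraT => /existsPn Tr0.
have m_gt0 := card_field_exp_gt0.
have := @card_linearized_roots F p 1 m.-1 (fun=> 1) chF.
rewrite (card_frobenius_fixed p_pr cardF) ?dvd1n // prednK //.
have -> : [set x : F | \sum_(i < m) 1 * x ^+ (p ^ (1 * i)) == 0] = setT.
  apply/setP => x; rewrite !inE; apply/eqP.
  have /negbNE/eqP Tx := Tr0 x; rewrite -[RHS](_ : ((Tr x : nat)%:R = 0 :> F)).
    by rewrite abs_traceE //; apply: eq_bigr => i _; rewrite mul1r mul1n.
  by rewrite Tx.
have ex : exists2 i, (i <= m.-1)%N & (1 : F) != 0 by exists 0%N; rewrite ?oner_eq0.
move/(_ ex); rewrite cardsT cardF expn1 leq_exp2l ?prime_gt1 //.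
by rewrite -ltnS prednK // ltnn.
Qed.

Lemma abs_trace_nondeg a : (forall y, Tr (a * y) = 0) -> a = 0.
Proof.
move=> Ta; apply/eqP; apply: contraT => a_neq0.
have [x] := abs_trace_nontrivial.
by rewrite -[x](mulVKf a_neq0) Ta eqxx.
Qed.

End Trace.

(** * Additive characters *)

Section Character.
Variables (p m : nat) (F : finFieldType) (z : algC).
Hypotheses (p_pr : prime p) (cardF : #|F| = (p ^ m)%N).
Hypothesis z_prim : p.-primitive_root z.
Local Notation Tr := (@abs_trace p m F).

Definition Fp_char (a : 'F_p) : algC := z ^+ (a : nat).
Definition trace_char (x : F) : algC := Fp_char (Tr x).

Lemma Fp_charD a b : Fp_char (a + b) = Fp_char a * Fp_char b.
Proof. rewrite /Fp_char -exprD -[RHS](prim_expr_mod z_prim) /=.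
by congr (_ ^+ (_ %% _)); apply: Fp_cast. Qed.

Lemma Fp_char0 : Fp_char 0 = 1. Proof. by []. Qed.

Lemma Fp_char_eq1 a : (Fp_char a == 1) = (a == 0).
Proof.
rewrite /Fp_char -(prim_order_dvd z_prim).
apply/idP/eqP => [|->]; last exact: dvdn0.
have a_lt : (a < p)%N by rewrite -[X in (_ < X)%N](Fp_cast p_pr).
by rewrite /dvdn modn_small // => /eqP a0; apply/val_inj.
Qed.

Lemma sum_Fp_char : \sum_a Fp_char a = 0.
Proof.
set S := \sum_a _; have chi1 : Fp_char 1 != 1 by rewrite Fp_char_eq1 oner_eq0.
have : Fp_char 1 * S = S.
  rewrite mulr_sumr [RHS](reindex_inj (addrI 1)) /=.
  by apply: eq_bigr => a _; rewrite Fp_charD.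
move/eqP; rewrite -subr_eq0 -[X in _ - X]mul1r -mulrBl mulf_eq0 subr_eq0.
by rewrite (negPf chi1) => /eqP.
Qed.

Lemma trace_charD x y : trace_char (x + y) = trace_char x * trace_char y.
Proof. by rewrite /trace_char (abs_traceD p_pr cardF) Fp_charD. Qed.

Lemma trace_char0 : trace_char 0 = 1.
Proof. by rewrite /trace_char (abs_trace0 p_pr cardF). Qed.

Lemma sum_trace_char (a : F) :
  \sum_y trace_char (y * a) = if a == 0 then #|F|%:R else 0.
Proof.
case: eqVneq => [->|a_neq0].
  by under eq_bigr do rewrite mulr0 trace_char0; rewrite sumr_const.
have [x0 Tx0] := abs_trace_nontrivial p_pr cardF.
set S := \sum_y _.
have chi1 : trace_char x0 != 1 by rewrite Fp_char_eq1.
have : trace_char x0 * S = S.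
  rewrite mulr_sumr [RHS](reindex_inj (addrI (x0 / a))) /=.
  by apply: eq_bigr => y _; rewrite mulrDl divfK // trace_charD.
move/eqP; rewrite -subr_eq0 -[X in _ - X]mul1r -mulrBl mulf_eq0 subr_eq0.
by rewrite (negPf chi1) => /eqP.
Qed.

(** Orthogonality turns a character sum over all [(g1, g2)] into a count of the
    common zeros of the two functions. *)
Lemma sum_trace_char_pair (I : finType) (f1 f2 : I -> F) :
  \sum_(g : F * F) \sum_i trace_char (g.1 * f1 i + g.2 * f2 i) =
  (#|F| ^ 2 * #|[set i | (f1 i == 0) && (f2 i == 0)]|)%:R.
Proof.
rewrite exchange_big /= -sum1_card big_distrr natr_sum /= [RHS]big_mkcond /=.
apply: eq_bigr => i _; rewrite inE muln1.
rewrite -(pair_bigA _ (fun a b => trace_char (a * f1 i + b * f2 i))) /=.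
under eq_bigr do under eq_bigr do rewrite trace_charD.
under eq_bigr do rewrite -mulr_sumr.
rewrite -mulr_suml !sum_trace_char.
by do 2!case: eqP => _; rewrite ?mul0r ?mulr0 // -natrM.
Qed.

End Character.

(** * Linear codes *)

Section LinearCodes.
Variables (K : finFieldType) (I : finType).
Implicit Types (C : {set {ffun I -> K^o}}) (c : {ffun I -> K^o}).

Lemma hdistE c c' : hdist c c' = hweight (c - c').
Proof. by apply: eq_card => i; rewrite !inE !ffunE subr_eq0. Qed.

Lemma hweight_eq0 c : (hweight c == 0%N) = (c == 0).
Proof.
rewrite /hweight cards_eq0; apply/eqP/eqP => [c0|->]; last first.
  by apply/setP => i; rewrite !inE ffunE eqxx.
apply/ffunP => i; rewrite ffunE; apply/eqP.
by have := in_set0 i; rewrite -c0 inE => /negbFE.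
Qed.

(** Over a finite field the dimension of a linear code can be read off from the number
    of its words. *)
Lemma is_code_of_submodule C (k w : nat) :
  0 \in C -> (forall a c c', c \in C -> c' \in C -> a *: c + c' \in C) ->
  #|C| = (#|K| ^ k)%N ->
  (exists2 c, c \in C & (c != 0) && (hweight c == w)) ->
  (forall c, c \in C -> c != 0 -> (w <= hweight c)%N) ->
  is_code #|I| k w C.
Proof.
move=> C0 Clin cardC [c1 c1C /andP[c1_neq0 /eqP c1w]] Cw.
have CE : C =i <<enum C>>%VS.
  move=> c; apply/idP/idP => [cC|]; first by rewrite memv_span ?mem_enum.
  move/coord_span ->; apply: (big_ind (fun c => c \in C)) => // [u v uC vC|i _].
    by rewrite -[u]scale1r Clin.
  rewrite -[_ *: _]addr0 Clin //.
  have lt_i : (i < size (enum C))%N by case: i => i /=; rewrite cardE.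
  by have := mem_nth 0 lt_i; rewrite mem_enum.
split=> //.
  exists <<enum C>>%VS => //; apply: (@expnI #|K|); first exact: finNzRing_gt1.
  by rewrite -card_vspace -cardC; apply: eq_card => c; rewrite CE.
have CB c c' : c \in C -> c' \in C -> c - c' \in C.
  by move=> cC c'C; rewrite addrC -scaleN1r Clin.
split=> [|c c' cC c'C neq_cc'].
  by exists c1, 0; rewrite hdistE subr0.
by rewrite hdistE Cw ?CB // subr_eq0.
Qed.

End LinearCodes.

Lemma card_image_count (T I : finType) (w : T -> I) (P : pred I) (R : pzSemiRingType) :
  injective w -> #|[set c in [set w t | t : T] | P c]|%:R = \sum_t (P (w t))%:R :> R.
Proof.
move=> w_inj; rewrite -natr_sum -sum1_card; congr (_%:R).
rewrite (eq_bigl (fun c => (c \in [set w t | t : T]) && P c)) => [|c]; last by rewrite inE.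
rewrite big_mkcondr big_imset /=; last by move=> ? ? _ _; apply: w_inj.
by apply: eq_big => t //=; case: (P _).
Qed.

Lemma sum_table (T : seq (rat * rat)) (w : rat) :
  \sum_(t <- T | t.1 == w) t.2 = \sum_(t <- T) (t.1 == w)%:R * t.2.
Proof.
by rewrite big_mkcond; apply: eq_bigr => t _; case: eqP; rewrite ?mul1r ?mul0r.
Qed.

(** * The linear system of the moments *)

(** The unknowns are the multiplicities of the nodes [(- q) ^ i].  Each of them is
    isolated by combining the four equations with the elementary symmetric functions of
    the other three nodes; [D] is [(q + 1) * (q ^+ 2 - 1) * (q ^+ 3 + 1)]. *)
Lemma moment_system_solution (K : fieldType) (q X e a0 a1 a2 a3 : K) :
  q != 0 -> e ^+ 2 = 1 ->
  a0 + a1 + a2 + a3 = X ^+ 4 - 1 ->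
  a0 - q * a1 + q ^+ 2 * a2 - q ^+ 3 * a3 = e * X * (X ^+ 2 - 1) ->
  a0 + q ^+ 2 * a1 + q ^+ 4 * a2 + q ^+ 6 * a3 = X ^+ 2 * (X ^+ 2 - 1) * (q + 1) ->
  a0 - q ^+ 3 * a1 + q ^+ 6 * a2 - q ^+ 9 * a3 = e * X * (X ^+ 2 - 1) * q ^+ 3 ->
  let D := q ^+ 6 + q ^+ 5 - q ^+ 4 + q ^+ 2 - q - 1 in
  let S := - 1 + q - q ^+ 2 + q ^+ 3 - q ^+ 4 + q ^+ 5 in
  [/\ a0 * D = X ^+ 4 * q ^+ 6 - X ^+ 4 * q ^+ 4 - X ^+ 4 * q + X ^+ 2 * q ^+ 4
        + X ^+ 2 * q - q ^+ 6
        + e * (X ^+ 3 * q ^+ 5 - X ^+ 3 * q ^+ 4 - X * q ^+ 5 + X * q ^+ 4),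
      a1 * D = X ^+ 4 / q ^+ 2 * (q ^+ 7 - q ^+ 2 - 1)
        + X ^+ 2 / q ^+ 2 * (q ^+ 5 - q ^+ 6 + q ^+ 2 + 1)
        - q ^+ 3 * (q ^+ 2 - q + 1) - e * (X ^+ 3 - X) * S,
      a2 * D = X ^+ 4 / q ^+ 3 * (q ^+ 5 + q - 1)
        - X ^+ 2 / q ^+ 3 * (q ^+ 6 + q ^+ 4 + q - 1)
        + q * (q ^+ 2 - q + 1) + e * (X ^+ 3 / q ^+ 2 - X / q ^+ 2) * S
    & a3 * D = X ^+ 4 / q ^+ 3 - X ^+ 2 - X ^+ 2 / q ^+ 3 + 1
        - e * (X ^+ 3 / q - X ^+ 3 / q ^+ 2 - X / q + X / q ^+ 2)].
Proof.
move=> q0 /eqP; rewrite sqrf_eq1 => e1 T0 T1 T2 T3 D S.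
(* [c1], [c2], [c3] stand for the elementary symmetric functions of three nodes. *)
pose comb c1 c2 c3 := e * X * (X ^+ 2 - 1) * q ^+ 3
  - c1 * (X ^+ 2 * (X ^+ 2 - 1) * (q + 1)) + c2 * (e * X * (X ^+ 2 - 1)) - c3 * (X ^+ 4 - 1).
have L0 : a0 * D = - comb (- q + q ^+ 2 - q ^+ 3) (- q ^+ 3 + q ^+ 4 - q ^+ 5) (q ^+ 6).
  by rewrite /comb -T3 -T2 -T1 -T0 /D; ring.
have L1 : q ^+ 2 * (a1 * D) = (q ^+ 2 - q + 1)
    * comb (1 + q ^+ 2 - q ^+ 3) (q ^+ 2 - q ^+ 3 - q ^+ 5) (- q ^+ 5).
  by rewrite /comb -T3 -T2 -T1 -T0 /D; ring.
have L2 : q ^+ 3 * (a2 * D) = (q ^+ 2 - q + 1)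
    * comb (1 - q - q ^+ 3) (- q - q ^+ 3 + q ^+ 4) (q ^+ 4).
  by rewrite /comb -T3 -T2 -T1 -T0 /D; ring.
have L3 : q ^+ 3 * (a3 * D) = - comb (1 - q + q ^+ 2) (- q + q ^+ 2 - q ^+ 3) (- q ^+ 3).
  by rewrite /comb -T3 -T2 -T1 -T0 /D; ring.
split.
- by rewrite L0 /comb; case/orP: e1 => /eqP ->; ring.
- apply: (mulfI (expf_neq0 2 q0)); rewrite L1 /comb /S.
  by case/orP: e1 => /eqP ->; field.
- apply: (mulfI (expf_neq0 3 q0)); rewrite L2 /comb /S.
  by case/orP: e1 => /eqP ->; field.
- apply: (mulfI (expf_neq0 3 q0)); rewrite L3 /comb.
  by case/orP: e1 => /eqP ->; field.
Qed.

Lemma DeltaE (p m l : nat) (q : rat := p%:R ^+ gcdn m l) :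
  Delta p m l = q ^+ 6 + q ^+ 5 - q ^+ 4 + q ^+ 2 - q - 1.
Proof. by rewrite /Delta ![(_ * gcdn m l)%N]mulnC !exprM. Qed.

Lemma Delta_neq0 (p m l : nat) : (1 < p)%N -> (0 < gcdn m l)%N -> Delta p m l != 0.
Proof.
move=> p_gt1 d_gt0; rewrite DeltaE; set q := p%:R ^+ gcdn m l.
have q_gt1 : 1 < q by rewrite exprn_egt1 ?ltr1n // -lt0n.
have q_gt0 : 0 < q by rewrite (lt_trans ltr01).
rewrite (_ : _ - 1 = (q + 1) * (q ^+ 2 - 1) * (q ^+ 3 + 1)); last by ring.
have q3_gt0 : 0 < q ^+ 3 by apply: exprn_gt0.
have q2_gt1 : 0 < q ^+ 2 - 1 by rewrite subr_gt0 exprn_egt1.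
by rewrite lt0r_neq0 // pmulr_rgt0 ?pmulr_rgt0 // addr_gt0.
Qed.

(** The bound on [gcdn m l] makes all subtractions in the exponents exact, so that each
    power of [p] is a monomial in [X] and [q ^-1] or [q]. *)
Lemma Freq_of_moments (p m l : nat) (a : nat -> rat) :
  (1 < p)%N -> (0 < gcdn m l)%N -> (m = m./2 * 2)%N -> (4 * gcdn m l <= m./2)%N ->
  let q : rat := p%:R ^+ gcdn m l in let X : rat := p%:R ^+ m./2 in let e := eps m l in
  a 0%N + a 1%N + a 2%N + a 3%N = X ^+ 4 - 1 ->
  a 0%N - q * a 1%N + q ^+ 2 * a 2%N - q ^+ 3 * a 3%N = e * X * (X ^+ 2 - 1) ->
  a 0%N + q ^+ 2 * a 1%N + q ^+ 4 * a 2%N + q ^+ 6 * a 3%N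
    = X ^+ 2 * (X ^+ 2 - 1) * (q + 1) ->
  a 0%N - q ^+ 3 * a 1%N + q ^+ 6 * a 2%N - q ^+ 9 * a 3%N
    = e * X * (X ^+ 2 - 1) * q ^+ 3 ->
  forall i, (i < 4)%N -> Freq p m l i = a i.
Proof.
set d := gcdn m l; set H := m./2; move=> p_gt1 d_gt0 mE dH q X e T0 T1 T2 T3.
have p0 : (p%:R : rat) != 0 by rewrite pnatr_eq0 -lt0n ltnW.
have q0 : q != 0 by rewrite expf_neq0.
have e2 : e ^+ 2 = 1 by rewrite /e /eps sqrr_sign.
have powM b c k : k = (b * H + c * d)%N -> p%:R ^+ k = X ^+ b * q ^+ c.
  by move=> ->; rewrite exprD !(mulnC _ H) (mulnC _ d) !exprM.
have powV b c k : (k + c * d = b * H)%N -> p%:R ^+ k = X ^+ b / q ^+ c.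
  move=> kE; apply: (canRL (mulfK (expf_neq0 c q0))).
  by rewrite -!exprM -exprD; congr (_ ^+ _); lia.
have [S0 S1 S2 S3] := moment_system_solution q0 e2 T0 T1 T2 T3.
have SE : Sigma p m l = - 1 + q - q ^+ 2 + q ^+ 3 - q ^+ 4 + q ^+ 5.
  rewrite /Sigma !big_ord_recl big_ord0 /= /bump /= -/d.
  rewrite !(mulnC _ d) !exprM -/q; ring.
move=> i i_lt; rewrite /Freq; apply: (canLR (mulfK (Delta_neq0 p_gt1 d_gt0))).
case: i i_lt => [|[|[|[|//]]]] _; rewrite DeltaE ?S0 ?S1 ?S2 ?S3 /DeltaF ?SE -/d -/H -/e.
- rewrite (powM 4 6 (2 * m + 6 * d))%N; last by lia.
  rewrite (powM 4 4 (2 * m + 4 * d))%N; last by lia.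
  rewrite (powM 4 1 (2 * m + d))%N; last by lia.
  rewrite (powM 2 4 (m + 4 * d))%N; last by lia.
  rewrite (powM 2 1 (m + d))%N; last by lia.
  rewrite (powM 0 6 (6 * d))%N; last by lia.
  rewrite (powM 3 5 (3 * H + 5 * d))%N; last by lia.
  rewrite (powM 3 4 (3 * H + 4 * d))%N; last by lia.
  rewrite (powM 1 5 (H + 5 * d))%N; last by lia.
  rewrite (powM 1 4 (H + 4 * d))%N; last by lia.
  ring.
- rewrite (powV 4 2 (2 * m - 2 * d))%N; last by lia.
  rewrite (powV 2 2 (m - 2 * d))%N; last by lia.
  rewrite (powM 0 7 (7 * d))%N; last by lia.
  rewrite (powM 0 2 (2 * d))%N; last by lia.
  rewrite (powM 0 5 (5 * d))%N; last by lia.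
  rewrite (powM 0 6 (6 * d))%N; last by lia.
  rewrite (powM 0 3 (3 * d))%N; last by lia.
  rewrite (powM 3 0 (3 * H))%N; last by lia.
  rewrite -/q -/X; field.
  by [].
- rewrite (powV 4 3 (2 * m - 3 * d))%N; last by lia.
  rewrite (powV 2 3 (m - 3 * d))%N; last by lia.
  rewrite (powM 0 5 (5 * d))%N; last by lia.
  rewrite (powM 0 6 (6 * d))%N; last by lia.
  rewrite (powM 0 4 (4 * d))%N; last by lia.
  rewrite (powM 0 2 (2 * d))%N; last by lia.
  rewrite (powV 3 2 (3 * H - 2 * d))%N; last by lia.
  rewrite (powV 1 2 (H - 2 * d))%N; last by lia.
  rewrite -/q; field.
  by [].
- rewrite (powV 4 3 (2 * m - 3 * d))%N; last by lia.
  rewrite (powV 2 3 (m - 3 * d))%N; last by lia.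
  rewrite (powM 2 0 m)%N; last by lia.
  rewrite (powV 3 1 (3 * H - d))%N; last by lia.
  rewrite (powV 3 2 (3 * H - 2 * d))%N; last by lia.
  rewrite (powV 1 1 (H - d))%N; last by lia.
  rewrite (powV 1 2 (H - 2 * d))%N; last by lia.
  field.
  by [].
Qed.

(** The numerator is [(X ^+ 2 - 1) / q ^+ 3 * (X ^+ 2 - q ^+ 3 - e * (q ^+ 2 - q) * X)],
    which is positive because [q ^+ 4 <= X].  This provides forms of corank [3]. *)
Lemma Freq3_neq0 (p m l : nat) :
  (1 < p)%N -> (0 < gcdn m l)%N -> (m = m./2 * 2)%N -> (4 * gcdn m l <= m./2)%N ->
  Freq p m l 3 != 0.
Proof.
set d := gcdn m l; set H := m./2; move=> p_gt1 d_gt0 mE dH.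
rewrite mulf_neq0 ?invr_eq0 ?Delta_neq0 //=.
have p0 : (p%:R : rat) != 0 by rewrite pnatr_eq0 -lt0n ltnW.
pose q : rat := p%:R ^+ d; pose X : rat := p%:R ^+ H.
have q0 : q != 0 by rewrite expf_neq0.
have powV b c k : (k + c * d = b * H)%N -> p%:R ^+ k = X ^+ b / q ^+ c.
  move=> kE; apply: (canRL (mulfK (expf_neq0 c q0))).
  by rewrite -!exprM -exprD; congr (_ ^+ _); lia.
rewrite -/d -/H.
rewrite (powV 4 3 (2 * m - 3 * d))%N; last by lia.
rewrite (powV 2 3 (m - 3 * d))%N; last by lia.
rewrite (powV 2 0 m)%N; last by lia.
rewrite (powV 3 1 (3 * H - d))%N; last by lia.
rewrite (powV 3 2 (3 * H - 2 * d))%N; last by lia.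
rewrite (powV 1 1 (H - d))%N; last by lia.
rewrite (powV 1 2 (H - 2 * d))%N; last by lia.
set e := eps m l.
rewrite (_ : _ - _ = (X ^+ 2 - 1) / q ^+ 3 * (X ^+ 2 - q ^+ 3 - e * (q ^+ 2 - q) * X));
  last by field.
have q_gt1 : 1 < q by rewrite exprn_egt1 ?ltr1n // -lt0n.
have X_ge : q ^+ 4 <= X by rewrite -exprM ler_eXn2l ?ltr1n // mulnC.
have q4 : q ^+ 3 * q <= X by rewrite -exprSr.
have q3 : q ^+ 2 * q = q ^+ 3 by rewrite -exprSr.
have q_gt0 : 0 < q by lra.
have q_ge2 : 2 <= q.
  by rewrite /q -natrX ler_nat (leq_trans p_gt1) // -{1}(expn1 p) leq_exp2l.
have q2_ge : q ^+ 2 * 2 <= q ^+ 3 by rewrite -q3 ler_wpM2l // exprn_ge0 // ltW.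
have q2_gt1 : 1 < q ^+ 2 by rewrite exprn_egt1.
have q3_gt : q ^+ 2 < q ^+ 3 by rewrite -q3 ltr_pMr //; lra.
have q3X : q ^+ 3 < X by rewrite (lt_le_trans _ q4) // ltr_pMr //; lra.
have X_gt1 : 1 < X by lra.
rewrite !mulf_neq0 ?invr_eq0 ?expf_neq0 //.
  by rewrite subr_eq0 gt_eqF // exprn_egt1.
rewrite lt0r_neq0 //.
have eX : e * (q ^+ 2 - q) * X <= (q ^+ 2 - q) * X.
  rewrite -mulrA ler_piMl //; last by rewrite /e /eps -signr_odd; case: odd.
  by rewrite mulr_ge0 ?(ltW (lt_trans ltr01 X_gt1)) // subr_ge0 ler_eXnr // ltW.
have XX : (q ^+ 2 + 1) * X < X ^+ 2.
  by rewrite expr2 ltr_pM2r; lra.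
have qX : X <= q * X by rewrite ler_peMl ?ltW //; lra.
have q2E : (q ^+ 2 - q) * X = q ^+ 2 * X - q * X by ring.
have q2E' : (q ^+ 2 + 1) * X = q ^+ 2 * X + X by ring.
rewrite {}q2E in eX; rewrite {}q2E' in XX.
move: (e * _ * X) (q ^+ 2 * X) (q * X) (q ^+ 3) (X ^+ 2) eX XX qX q3X => A B C D E *.
by lra.
Qed.

(** * Numerical bounds *)

Lemma alternating_power_bounds (R : realFieldType) (q X : R) (i : nat) :
  1 <= q -> 0 <= X -> (i < 4)%N -> - (q ^+ 3 * X) <= X * (- q) ^+ i <= q ^+ 2 * X.
Proof.
move=> q_ge1 X_ge0 lt_i.
have q2 : q <= q ^+ 2 by rewrite ler_eXnr.
have q3 : q <= q ^+ 3 by rewrite ler_eXnr.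
have X1 : X <= q ^+ 2 * X by rewrite ler_peMl //; lra.
have X2 : 0 <= q ^+ 3 * X by rewrite mulr_ge0 //; lra.
have X3 : q * X <= q ^+ 3 * X by rewrite ler_wpM2r.
have X4 : 0 <= q * X by rewrite mulr_ge0 //; lra.
have q3N : (- q) ^+ 3 = - q ^+ 3 by ring.
case: i lt_i => [|[|[|[|//]]]] _;
  rewrite ?expr0 ?expr1 ?sqrrN ?q3N ?mulr1 ?mulrN ?(mulrC X).
all: move: (q ^+ 3 * X) (q ^+ 2 * X) (q * X) X1 X2 X3 X4 => C B A X1 X2 X3 X4.
all: apply/andP; split; lra.
Qed.

(** The left-hand sides are the sizes of the fibres of a form over [0] and over a
    nonzero value; its exponential sum is [S] in the first two, [- S] in the last two. *)
Lemma fibre_bounds (R : realFieldType) (p q X S : R) :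
  3 <= p -> p <= q -> 1 <= X -> - (q ^+ 3 * X) <= S <= q ^+ 2 * X ->
  [/\ (X ^+ 2 + (p - 1) * S) / p <= (X ^+ 2 + q ^+ 3 * X) / p,
      (X ^+ 2 - S) / p <= (X ^+ 2 + q ^+ 3 * X) / p,
      (X ^+ 2 - (p - 1) * S) / p <= (X ^+ 2 + (p - 1) * q ^+ 3 * X) / p
    & (X ^+ 2 + S) / p <= (X ^+ 2 + (p - 1) * q ^+ 3 * X) / p - 1].
Proof.
move=> p3 pq X1 /andP[lo hi].
have q1 : 1 <= q by lra.
have p0 : 0 < p^-1 by rewrite invr_gt0; lra.
pose Y := q ^+ 2 * X.
have Y1 : p <= Y.
  rewrite (le_trans pq) // (le_trans (_ : q <= q ^+ 2)) ?ler_eXnr //.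
  by rewrite ler_peMr // exprn_ge0 //; lra.
have q3E : q ^+ 3 * X = q * Y by rewrite /Y mulrA -exprS.
have pY : (p - 1) * Y <= q * Y by rewrite ler_wpM2r //; lra.
have pY2 : 2 * (q * Y) <= (p - 1) * (q * Y).
  by rewrite ler_wpM2r ?mulr_ge0 //; lra.
have qY : Y <= q * Y by rewrite ler_peMl //; lra.
have p_neq0 : p != 0 by rewrite lt0r_neq0 //; lra.
have -> : (X ^+ 2 + S) / p = (X ^+ 2 + S + p) / p - 1 by field.
rewrite lerD2r -!(mulrA (p - 1)) !ler_pM2r // q3E -/Y in lo hi *.
have pS : (p - 1) * S <= (p - 1) * Y by rewrite ler_wpM2l //; lra.
have pS2 : (p - 1) * - (q * Y) <= (p - 1) * S by rewrite ler_wpM2l //; lra.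
rewrite mulrN in pS2.
move: (q * Y) ((p - 1) * S) ((p - 1) * Y) ((p - 1) * (q * Y)) lo hi Y1 pY pY2 qY pS pS2
  {q3E p_neq0 p0} => A B C D lo hi Y1 pY pY2 qY pS pS2.
by split; lra.
Qed.

Lemma fibre_bound_lt (R : realFieldType) (p q X : R) :
  3 <= p -> p <= q -> q ^+ 4 <= X ->
  (X ^+ 2 + q ^+ 3 * X) / p < X ^+ 2 - 1 /\
  (X ^+ 2 + (p - 1) * q ^+ 3 * X) / p < X ^+ 2 - 1.
Proof.
move=> p3 pq qX; have p_gt0 : 0 < p by lra.
have q1 : 1 <= q by lra.
have q3_ge1 : 1 <= q ^+ 3 by rewrite exprn_ege1.
have X3 : 3 * q ^+ 3 <= X.
  by rewrite (le_trans _ qX) // exprS ler_wpM2r //; lra.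
have X_ge0 : 0 <= X by lra.
have XX : 3 * (q ^+ 3 * X) <= X ^+ 2 by rewrite mulrA expr2 ler_wpM2r.
have X2 : 9 <= X ^+ 2.
  rewrite expr2 (le_trans (_ : 9 <= 3 * X)) ?ler_wpM2r //; lra.
have pX : 2 * X ^+ 2 <= (p - 1) * X ^+ 2 by rewrite ler_wpM2r //; lra.
have pXX : (p - 1) * (3 * (q ^+ 3 * X)) <= (p - 1) * X ^+ 2 by rewrite ler_wpM2l //; lra.
have p9 : (p - 1) * 9 <= (p - 1) * X ^+ 2 by rewrite ler_wpM2l //; lra.
rewrite !ltr_pdivrMr // -[(p - 1) * _ * _]mulrA.
move: (q ^+ 3 * X) XX pXX {q3_ge1 X3} => Y XX pXX.
by split; lra.
Qed.

(** * Orthogonality in dimension three *)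

(** Let [a_i = (u_i, v_i, 1)].  The vectors [a_0] and [a_2] are orthogonal to [a_1] and
    [a_3].  If [a_0] and [a_2] differ, so do [a_1] and [a_3], and both pairs span planes,
    since vectors with last coordinate [1] are proportional only when they are equal;
    two planes cannot be orthogonal in dimension [3]. *)
Lemma orthogonal_pairs (K : fieldType) (u0 u1 u2 u3 v0 v1 v2 v3 : K) :
  u1 * u0 + v1 * v0 + 1 = 0 -> u2 * u1 + v2 * v1 + 1 = 0 ->
  u3 * u2 + v3 * v2 + 1 = 0 -> u3 * u0 + v3 * v0 + 1 = 0 ->
  (u2 != u0 -> u3 != u1) -> (v2 != v0 -> v3 != v1) -> u2 = u0 /\ v2 = v0.
Proof.
move=> E01 E12 E23 E03 du dv.
pose A := u2 - u0; pose B := v2 - v0; pose A1 := u3 - u1; pose B1 := v3 - v1.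
have oA : A * u1 + B * v1 = 0.
  by transitivity ((u2 * u1 + v2 * v1 + 1) - (u1 * u0 + v1 * v0 + 1));
    [rewrite /A /B; ring | rewrite E12 E01 subrr].
have oA1 : u0 * A1 + v0 * B1 = 0.
  by transitivity ((u3 * u0 + v3 * v0 + 1) - (u1 * u0 + v1 * v0 + 1));
    [rewrite /A1 /B1; ring | rewrite E03 E01 subrr].
have oAA : A * A1 + B * B1 = 0.
  transitivity ((u3 * u2 + v3 * v2 + 1) - (u2 * u1 + v2 * v1 + 1) - (u0 * A1 + v0 * B1)).
    by rewrite /A /B /A1 /B1; ring.
  by rewrite E12 E23 oA1 !subrr.
(* [(A1, B1)] is orthogonal to both [(u0, v0)] and [(A, B)]. *)
have det0 : (A1 != 0) || (B1 != 0) -> u0 * B - v0 * A = 0.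
  case/orP => nz; apply: (mulfI nz); rewrite mulr0.
    transitivity (B * (u0 * A1 + v0 * B1) - v0 * (A * A1 + B * B1)); first by ring.
    by rewrite oA1 oAA !mulr0 subrr.
  transitivity (u0 * (A * A1 + B * B1) - A * (u0 * A1 + v0 * B1)); first by ring.
  by rewrite oA1 oAA !mulr0 subrr.
have AE : A = A * (u1 * u0 + v1 * v0 + 1) - u0 * (A * u1 + B * v1) + v1 * (u0 * B - v0 * A).
  by clear; clearbody A B; ring.
have BE : B = B * (u1 * u0 + v1 * v0 + 1) - v0 * (A * u1 + B * v1) - u1 * (u0 * B - v0 * A).
  by clear; clearbody A B; ring.
split; apply/eqP; apply: contraT => neq.
  have det : u0 * B - v0 * A = 0 by apply: det0; rewrite subr_eq0 du.
  by move: neq; rewrite -subr_eq0 -/A AE E01 oA det !mulr0 subrr addr0 eqxx.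
have det : u0 * B - v0 * A = 0 by apply: det0; rewrite !subr_eq0 dv ?orbT.
by move: neq; rewrite -subr_eq0 -/B BE E01 oA det !mulr0 !subrr eqxx.
Qed.

Section HermitianForms.
Variables (p m l : nat) (F : finFieldType).
Hypotheses (p_pr : prime p) (p_odd : odd p) (l_gt0 : (0 < l)%N).
Hypothesis cardF : #|F| = (p ^ m)%N.
Hypotheses (ml_even : ~~ odd (m %/ gcdn m l)) (m_gt6l : (6 * l < m)%N).

Let chF : p \in [pchar F] := card_finPcharP cardF p_pr.
Local Notation Tr := (@abs_trace p m F).
Local Notation d := (gcdn m l).
Local Notation q := (p ^ d)%N.
Local Notation n := ((m %/ d)./2).

(** * The parameters *)

Lemma delta_gt0 : (0 < d)%N.
Proof. by rewrite gcdn_gt0 l_gt0 orbT. Qed.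

Lemma m_eq : m = (n * d * 2)%N.
Proof.
rewrite mulnAC muln2 halfK (negPf ml_even) subn0 divnK ?dvdn_gcdl //.
Qed.

Lemma halfm_eq : m./2 = (n * d)%N.
Proof. by rewrite {1}m_eq muln2 doubleK. Qed.

(** The Hermitian dimension [n] exceeds the largest corank [3] of a nonzero form. *)
Lemma halfdim_gt3 : (3 < n)%N.
Proof.
have d_gt0 := delta_gt0; have d_le : (d <= l)%N by rewrite dvdn_leq ?dvdn_gcdr.
have := m_gt6l; have := m_eq; set k := n => -> lt6.
have : (3 * d < k * d)%N by lia.
by rewrite ltn_pmul2r.
Qed.

Lemma coprime_quotients : coprime (m %/ d) (l %/ d).
Proof.
rewrite /coprime -(eqn_pmul2r delta_gt0) muln_gcdl !divnK ?dvdn_gcdl ?dvdn_gcdr //.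
by rewrite mul1n.
Qed.

(** [m / d] is even and prime to [l / d]. *)
Lemma odd_l_quotient : odd (l %/ d).
Proof.
have := coprime_quotients.
apply: contraTT => l_even; apply/negP => cop.
have := coprime_dvdl (_ : 2 %| m %/ d)%N cop.
by rewrite dvdn2 coprime2n (negPf l_even) => /(_ ml_even).
Qed.

Lemma q_gt2 : (2 < q)%N.
Proof.
have p_gt2 : (2 < p)%N by rewrite odd_prime_gt2.
by rewrite (leq_trans p_gt2) // -{1}(expn1 p) leq_exp2l ?prime_gt1 ?delta_gt0.
Qed.

Let q_gt0 : (0 < q)%N. Proof. exact: ltn_trans q_gt2. Qed.

Lemma q_odd : odd q.
Proof. by rewrite oddX p_odd orbT. Qed.

Lemma expm_eq : (p ^ m = q ^ (n * 2))%N.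
Proof. by rewrite {1}m_eq -expnM; congr (_ ^ _)%N; lia. Qed.

(** [F] contains the subfield of order [q ^ 2]. *)
Lemma dvdn_norm_group : (q.+1 * q.-1 %| #|F|.-1)%N.
Proof.
have -> : (q.+1 * q.-1 = (q ^ 2).-1)%N by have := q_gt0; case: q => // k _; lia.
by rewrite cardF expm_eq mulnC expnM dvdn_pred_predX.
Qed.

Let norm_group_gt0 : (0 < q.+1 * q.-1)%N.
Proof. by have := q_gt2; case: q => // k; lia. Qed.

(** * The subfield of order [q ^ 2] *)

(** An odd power of the Frobenius map of [GF(q)] acts on [GF(q^2)] as the
    conjugation. *)
Lemma conj_odd k (x : F) : odd k -> x ^+ (p ^ (2 * d)) = x -> x ^+ (p ^ (k * d)) = x ^+ q.
Proof.
move=> k_odd xK; rewrite -(odd_double_half k) k_odd addnC.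
elim: k./2 => [|j IHj]; first by rewrite mul1n.
have -> : ((j.+1.*2 + true) * d = 2 * d + (j.*2 + true) * d)%N by lia.
by rewrite expnD exprM xK.
Qed.

Lemma l_eq : l = (l %/ d * d)%N. Proof. by rewrite divnK ?dvdn_gcdr. Qed.

Lemma conj_l (x : F) : x ^+ (p ^ (2 * d)) = x -> x ^+ (p ^ l) = x ^+ q.
Proof. by move=> xK; rewrite {1}l_eq conj_odd ?odd_l_quotient. Qed.

Lemma conj_3l (x : F) : x ^+ (p ^ (2 * d)) = x -> x ^+ (p ^ (3 * l)) = x ^+ q.
Proof.
by move=> xK; rewrite {1}l_eq mulnA conj_odd // oddM odd_l_quotient.
Qed.

(** If the norm [c] is a nonzero element of the subfield of order [q], then
    [x ^+ (q ^ 2 - 1) = c ^+ (q - 1) = 1]. *)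
Lemma norm_in_subfield (x c : F) :
  c ^+ q.-1 = 1 -> x ^+ q.+1 = c -> x ^+ (p ^ (2 * d)) = x.
Proof.
move=> c1 xc; rewrite mulnC expnM.
have -> : (q ^ 2 = (q.+1 * q.-1).+1)%N by have := q_gt0; case: q => // k _; lia.
by rewrite exprS exprM xc c1 mulr1.
Qed.

Lemma card_norm_fibre (c : F) : c ^+ q.-1 = 1 -> #|[set x : F | x ^+ q.+1 == c]| = q.+1.
Proof. exact: card_power_fibre dvdn_norm_group norm_group_gt0. Qed.

Lemma exists_norm (c : F) : c ^+ q.-1 = 1 -> exists x, x ^+ q.+1 = c.
Proof. exact: exists_root_of_power dvdn_norm_group norm_group_gt0. Qed.

Lemma fixed_q_unity (c : F) : c != 0 -> c ^+ q = c -> c ^+ q.-1 = 1.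
Proof.
by move=> c_neq0 cq; apply: (mulfI c_neq0); rewrite -exprS prednK ?q_gt0 // cq mulr1.
Qed.

(** * The quadratic forms *)

Definition qarg (g : F * F) (x : F) : F :=
  g.1 * x ^+ (p ^ l).+1 + g.2 * x ^+ (p ^ (3 * l)).+1.

Definition qform (g : F * F) (x : F) : 'F_p := Tr (qarg g x).

Definition qform_fibre g (a : 'F_p) : nat := #|[set x | qform g x == a]|.
Local Notation N := qform_fibre.

(** The form is Hermitian over the subfield of order [q ^ 2]: a scalar of this
    subfield comes out as its norm. *)
Lemma qarg_scale g (c x y : F) :
  c ^+ q.-1 = 1 -> x ^+ q.+1 = c -> qarg g (x * y) = c * qarg g y.
Proof.
move=> c1 xc; have xK := norm_in_subfield c1 xc.
rewrite /qarg !exprMn ![x ^+ _.+1]exprS conj_l // conj_3l // -exprS xc.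
by rewrite mulrDr !(mulrCA c).
Qed.

(** Every nonzero element of the prime field is a norm, and multiplication by an element
    of norm [a] carries the fibre over [1] to the fibre over [a]. *)
Lemma qform_fibre_const g a : a != 0 -> N g a = N g 1.
Proof.
move=> a_neq0; pose c : F := (a : nat)%:R.
have c_neq0 : c != 0 by rewrite (Fp_natr_eq0 chF).
have c1 : c ^+ q.-1 = 1 by rewrite fixed_q_unity // Fp_natr_frobenius.
have [x xc] := exists_norm c1.
have x_neq0 : x != 0.
  by apply: contraNneq c_neq0 => x0; rewrite -xc x0 expr0n.
rewrite /N -[RHS](card_imset _ (mulfI x_neq0)); apply: eq_card => y.
rewrite [LHS]inE; apply/eqP/imsetP => [Qy|[w]].
  exists (y / x); last by rewrite mulrC divfK.
  rewrite inE; apply/eqP/(mulfI a_neq0); rewrite mulr1 -abs_traceZ //.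
  by rewrite -(qarg_scale _ _ c1 xc) mulrC divfK.
rewrite inE => /eqP Qw ->.
by rewrite /qform (qarg_scale _ _ c1 xc) abs_traceZ // -/(qform _ _) Qw mulr1.
Qed.

Lemma sum_qform (R : nmodType) (f : 'F_p -> R) g :
  \sum_x f (qform g x) = \sum_a f a *+ N g a.
Proof.
rewrite (partition_big (qform g) predT) //=; apply: eq_bigr => a _.
rewrite -sumr_const big_mkcond [RHS]big_mkcond; apply: eq_bigr => x _.
by rewrite inE; case: eqP => // ->.
Qed.

Lemma sum_Fp_const (R : nmodType) (f : 'F_p -> R) (u : R) :
  (forall a, a != 0 -> f a = u) -> \sum_a f a = f 0 + u *+ p.-1.
Proof.
move=> fu; rewrite (bigD1 0) //= (eq_bigr (fun=> u)) // sumr_const.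
by congr (_ + _ *+ _); rewrite cardC1 card_Fp.
Qed.

Lemma qform_fibre_sum g : (N g 0%R + p.-1 * N g 1%R = p ^ m)%N.
Proof.
rewrite -cardF -[RHS]sum1_card; have := sum_qform (fun=> 1%N) g => /= ->.
rewrite (sum_Fp_const (u := N g 1)); first by rewrite natn -mulr_natr natn mulnC.
by move=> a /qform_fibre_const ->; rewrite natn.
Qed.

(** * The exponential sum *)

(** The value of the exponential sum of the form: since the nonzero values are
    equally frequent, the sum is an integer and does not depend on the chosen
    root of unity. *)
Definition expsum g : int := (N g 0)%:Z - (N g 1)%:Z.

Lemma sum_Fp_char_qform z g (c : 'F_p) : p.-primitive_root z -> c != 0 ->
  \sum_x Fp_char z (c * qform g x) = (expsum g)%:~R.
Proof.
move=> z_prim c_neq0; rewrite (sum_qform (fun a => Fp_char z (c * a))) (bigD1 0) //=.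
rewrite (eq_bigr (fun a => Fp_char z (c * a) *+ N g 1)); last first.
  by move=> a /qform_fibre_const ->.
have := sum_Fp_char p_pr z_prim; rewrite (reindex_inj (mulfI c_neq0)) /= (bigD1 0) //=.
rewrite mulr0 Fp_char0 sumrMnl => /eqP; rewrite addrC addr_eq0 => /eqP ->.
by rewrite mulNrn rmorphB.
Qed.

Lemma sum_trace_char_qarg z g : p.-primitive_root z ->
  \sum_x trace_char p m z (qarg g x) = (expsum g)%:~R.
Proof.
move=> z_prim; rewrite -(sum_Fp_char_qform g z_prim (oner_neq0 _)).
by apply: eq_bigr => x _; rewrite mul1r.
Qed.

Lemma qarg_unity g x u : u ^+ q.+1 = 1 -> qarg g (u * x) = qarg g x.
Proof. by move=> u1; rewrite (qarg_scale _ _ (expr1n _ _) u1) mul1r. Qed.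

Lemma qarg0 g : qarg g 0 = 0.
Proof. by rewrite /qarg !expr0n !mulr0 addr0. Qed.

Lemma qform0 g : qform g 0 = 0.
Proof. by rewrite /qform qarg0 abs_trace0. Qed.

(** The group of elements of norm [1] acts freely on the nonzero elements and
    preserves the form, and it has order [q + 1]. *)
Lemma expsum_mod g : exists k : int, expsum g = 1 + k * q.+1%:Z.
Proof.
have q1_gt0 : (0 < q.+1)%N by [].
have dvd_q1 : (q.+1 %| #|F|.-1)%N := dvdn_trans (dvdn_mulr _ (dvdnn _)) dvdn_norm_group.
have stab a : (q.+1 %| #|[set x | qform g x == a] :\ 0%R|)%N.
  apply: (dvdn_card_unity_stable dvd_q1) => //; first by rewrite !inE eqxx.
  move=> x z; rewrite !inE => /andP[x_neq0 Qx] z1.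
  rewrite mulf_neq0 //=; first by rewrite /qform qarg_unity.
  by apply: contra_eq_neq z1 => ->; rewrite expr0n eq_sym oner_neq0.
have /dvdnP[k1 def_k1] := stab 1; have /dvdnP[k0 def_k0] := stab 0.
exists (k0%:Z - k1%:Z); rewrite /expsum /N (cardsD1 0%R) inE qform0 eqxx def_k0.
rewrite [in X in _ - X](cardsD1 0%R) inE qform0 eq_sym oner_eq0 def_k1 /= add0n.
by rewrite mulrBl !PoszD !PoszM addrA.
Qed.

(** * The radical *)

(** The polarisation of the form is a sum of four traces.  Applying to each of them the
    power of the Frobenius map that turns its power of [y] into [y ^+ p ^ (3 * l)] makes
    this the coefficient of that factor; it is a linearized polynomial in [u] of degree
    [6] in [x ^+ p ^ l]. *)
Definition radical_poly g (u : F) : F :=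
  g.2 * u + g.1 ^+ (p ^ (2 * l)) * u ^+ (p ^ (2 * l))
  + g.1 ^+ (p ^ (3 * l)) * u ^+ (p ^ (4 * l))
  + g.2 ^+ (p ^ (3 * l)) * u ^+ (p ^ (6 * l)).

(** The exponent inverts [x ^+ p ^ (3 * l)], because [x ^+ p ^ m = x]. *)
Definition polar g (u : F) : F := radical_poly g u ^+ (p ^ (3 * l * m.-1)).

Definition radical g : {set F} := [set u | polar g u == 0].

Let m_gt0 : (0 < m)%N := card_field_exp_gt0 cardF.

Lemma polar_conj g u : polar g u ^+ (p ^ (3 * l)) = radical_poly g u.
Proof.
rewrite /polar -exprM -expnD -mulnSr prednK //.
elim: (3 * l)%N => [|k IHk]; first by rewrite expr1.
by rewrite mulSn expnD exprM -cardF expf_card IHk.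
Qed.

Lemma qformD g u y : qform g (u + y) = qform g u + qform g y + Tr (polar g u * y).
Proof.
have TrX k x : Tr (x ^+ (p ^ k)) = Tr x := abs_trace_frobenius p_pr cardF k x.
rewrite -(TrX (3 * l)%N (polar g u * y)) exprMn polar_conj.
rewrite /radical_poly !mulrDl !(abs_traceD p_pr cardF).
have -> : Tr (g.1 ^+ (p ^ (2 * l)) * u ^+ (p ^ (2 * l)) * y ^+ (p ^ (3 * l))) =
          Tr (g.1 * u * y ^+ (p ^ l)).
  by rewrite -[RHS](TrX (2 * l)%N) !exprMn -!exprM -!expnD -mulSn.
have -> : Tr (g.1 ^+ (p ^ (3 * l)) * u ^+ (p ^ (4 * l)) * y ^+ (p ^ (3 * l))) =
          Tr (g.1 * u ^+ (p ^ l) * y).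
  by rewrite -[RHS](TrX (3 * l)%N) !exprMn -!exprM -!expnD -mulSn.
have -> : Tr (g.2 ^+ (p ^ (3 * l)) * u ^+ (p ^ (6 * l)) * y ^+ (p ^ (3 * l))) =
          Tr (g.2 * u ^+ (p ^ (3 * l)) * y).
  by rewrite -[RHS](TrX (3 * l)%N) !exprMn -!exprM -!expnD -mulnDl.
rewrite /qform /qarg -!(abs_traceD p_pr cardF); congr Tr.
rewrite ![_ ^+ _.+1]exprS !frobeniusD //; ring.
Qed.

Lemma radical_polyD g u v : radical_poly g (u + v) = radical_poly g u + radical_poly g v.
Proof. rewrite /radical_poly !frobeniusD //; ring. Qed.

Lemma polarD g u v : polar g (u + v) = polar g u + polar g v.
Proof. by rewrite /polar radical_polyD frobeniusD. Qed.

Lemma mem_radical g u : (u \in radical g) = (radical_poly g u == 0).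
Proof.
rewrite inE /polar expf_eq0 expn_gt0 prime_gt0 //.
Qed.

Lemma polar0 g : polar g 0 = 0.
Proof. by apply: (addrI (polar g 0)); rewrite -polarD !addr0. Qed.

Lemma polarN g u : polar g (- u) = - polar g u.
Proof. by apply: (addrI (polar g u)); rewrite -polarD !subrr polar0. Qed.

Lemma radical0 g : 0 \in radical g.
Proof. by rewrite inE polar0. Qed.

(** The characteristic is odd, so a form vanishes on its radical. *)
Lemma qform_radical g u : u \in radical g -> qform g u = 0.
Proof.
rewrite inE => /eqP u0.
have QN : qform g (- u) = qform g u.
  rewrite -mulN1r /qform (@qarg_unity g u (-1)) //.
  by rewrite -signr_odd /= q_odd.
have := qformD g u (- u); rewrite subrr u0 mul0r abs_trace0 // qform0 QN addr0.
move/esym/eqP; rewrite -mulr2n -mulr_natl mulf_eq0 => /orP[|/eqP //].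
rewrite -(dvdn_pcharf (pchar_Fp p_pr)) gtnNdvd //.
by rewrite odd_prime_gt2.
Qed.

(** [|S|^2] is the sum of the character values of [Q(u + y) - Q(y)], and for
    fixed [u] the sum over [y] vanishes unless [u] is in the radical. *)
Lemma expsum_sqr g : expsum g ^+ 2 = (p ^ m * #|radical g|)%:Z.
Proof.
have [z z_prim] := C_prim_root_exists (prime_gt0 p_pr).
have chiD := Fp_charD p_pr z_prim.
apply: (@intr_inj algC); rewrite rmorphXn /= expr2.
have N1_neq0 : (-1 : 'F_p) != 0 by rewrite oppr_eq0 oner_eq0.
rewrite -{1}(sum_Fp_char_qform g z_prim N1_neq0) -(sum_trace_char_qarg g z_prim).
rewrite mulr_suml.
transitivity (\sum_u \sum_y Fp_char z (qform g u) * trace_char p m z (y * polar g u)).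
  rewrite exchange_big; apply: eq_bigr => y _.
  rewrite mulr_sumr (reindex_inj (addIr y)) /=; apply: eq_bigr => u _.
  rewrite /trace_char -/(qform _ _) -!chiD qformD; congr Fp_char.
  by rewrite (mulrC y); ring.
transitivity (\sum_(u in radical g) #|F|%:R : algC).
  rewrite [RHS]big_mkcond /=; apply: eq_bigr => u _; rewrite -mulr_sumr.
  rewrite (sum_trace_char p_pr cardF z_prim) (_ : (_ == 0) = (u \in radical g)).
    2: by rewrite inE.
  case: ifP => u_rad; last by rewrite mulr0.
  by rewrite qform_radical // Fp_char0 mul1r.
by rewrite sumr_const cardF -[LHS]mulr_natr -natrM.
Qed.

Lemma card_polar_fibre g y : #|[set v | polar g v == polar g y]| = #|radical g|.
Proof.
rewrite -[RHS](card_imset _ (addrI y)); apply: eq_card => v.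
rewrite [LHS]inE; apply/eqP/imsetP => [vy|[u]].
  exists (v - y); last by rewrite addrC subrK.
  by rewrite inE polarD polarN vy subrr.
by rewrite inE => /eqP u0 ->; rewrite polarD u0 addr0.
Qed.

(** The fibres of the additive map [polar g] are the cosets of the radical. *)
Lemma sum_polar (R : nmodType) (f : F -> R) g :
  \sum_y f (polar g y) = (\sum_(b in [set polar g y | y : F]) f b) *+ #|radical g|.
Proof.
rewrite -sumrMnl (partition_big_imset (polar g)); apply: eq_bigr => _ /imsetP[y _ ->].
rewrite (eq_bigr (fun=> f (polar g y))) => [|v /andP[_ /eqP -> //]].
rewrite sumr_const -(card_polar_fibre g y); congr (_ *+ _); apply: eq_card => v.
by rewrite inE.
Qed.

Lemma card_polar_image g : (#|[set polar g y | y : F]| * #|radical g| = p ^ m)%N.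
Proof.
have := sum_polar (fun=> 1%N) g.
by rewrite !sum1_card -cardF -mulr_natr natn.
Qed.

Lemma frobenius_subfield k (x : F) :
  x ^+ (p ^ (2 * d)) = x -> x ^+ (p ^ (2 * k * l)) = x.
Proof.
move=> xK; rewrite {1}l_eq.
have -> : (2 * k * (l %/ d * d) = (k * (l %/ d)) * (2 * d))%N by lia.
elim: (k * _)%N => [|j IHj]; first by rewrite expr1.
by rewrite mulSn expnD exprM xK.
Qed.

(** The exponents of [u] in [radical_poly] belong to even powers of [x ^+ p ^ l], which fix
    the elements of the subfield of order [q ^ 2]. *)
Lemma radical_stable g u z : z ^+ (q.+1 * q.-1) = 1 -> u \in radical g -> z * u \in radical g.
Proof.
move=> z1; have zK := norm_in_subfield (etrans (esym (exprM _ _ _)) z1) (erefl _).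
rewrite !mem_radical.
suff -> : radical_poly g (z * u) = z * radical_poly g u.
  by move=> /eqP ->; rewrite mulr0.
have [z2 z4 z6] : [/\ z ^+ (p ^ (2 * l)) = z, z ^+ (p ^ (4 * l)) = z
                    & z ^+ (p ^ (6 * l)) = z].
  by have := frobenius_subfield _ zK => /[dup] /(_ 1%N) ? /[dup] /(_ 2%N) ? /(_ 3%N).
by rewrite /radical_poly !exprMn z2 z4 z6; ring.
Qed.

(** The nonzero elements of the radical are permuted freely by the nonzero
    elements of the subfield of order [q ^ 2]. *)
Lemma card_radical_exp g : exists i, #|radical g| = (q ^ (2 * i))%N.
Proof.
have /(dvdn_pfactor _ _ p_pr)[j _ def_j] : (#|radical g| %| p ^ m)%N.
  by rewrite -(card_polar_image g) dvdn_mull.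
have : ((p ^ (2 * d)).-1 %| (p ^ j).-1)%N.
  have -> : ((p ^ (2 * d)).-1 = q.+1 * q.-1)%N.
    by rewrite mulnC expnM; have := q_gt0; case: (q) => // k _; lia.
  rewrite -def_j (cardsD1 0) radical0 add1n /=.
  apply: (dvdn_card_unity_stable dvdn_norm_group) => // [|x z].
    by rewrite !inE eqxx.
  rewrite in_setD1 => /andP[x_neq0 x_rad] z1.
  rewrite in_setD1 radical_stable // andbT mulf_neq0 //.
  by apply: contra_eq_neq z1 => ->; rewrite expr0n gtn_eqF // eq_sym oner_neq0.
move=> /(dvdn_pred_exp (prime_gt1 p_pr))/dvdnP[i def_i].
by exists i; rewrite def_j def_i -expnM; congr (_ ^ _)%N; lia.
Qed.

(** The radical of a nonzero form consists of roots of a linearized polynomial of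
    degree at most [6] in the Frobenius map [x ^+ p ^ l], whose fixed field has
    order [q]. *)
Lemma card_radical_le g : g != 0 -> (#|radical g| <= q ^ 6)%N.
Proof.
move=> g_neq0.
pose a := nth 0 [:: g.2; 0; g.1 ^+ (p ^ (2 * l)); 0; g.1 ^+ (p ^ (3 * l)); 0;
                    g.2 ^+ (p ^ (3 * l))].
have a_neq0 : exists2 i, (i <= 6)%N & a i != 0.
  have [g20|g2] := eqVneq g.2 0; last by exists 0%N.
  exists 2%N => //; rewrite expf_neq0 //; apply: contraNneq g_neq0 => g10.
  by rewrite [g]surjective_pairing g10 g20.
have := card_linearized_roots l chF a_neq0.
have -> : #|[set x : F | x ^+ (p ^ l) == x]| = q.
  rewrite -(card_frobenius_fixed p_pr cardF (dvdn_gcdl _ _) delta_gt0).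
  apply: eq_card => x; rewrite !inE; apply/eqP/eqP => [xl|xd].
    by apply: frobenius_fixed_gcd => //; rewrite -cardF expf_card.
  rewrite {1}l_eq; elim: (l %/ d)%N => [|k IHk]; first by rewrite expr1.
  by rewrite mulSn expnD exprM xd.
congr (_ <= _)%N; apply: eq_card => x; rewrite mem_radical inE /a.
rewrite !big_ord_recl big_ord0 /= /bump /= !mul0r !add0r muln0 expr1 !addr0 !addrA.
by rewrite !(mulnC l).
Qed.

Lemma card_radical g : g != 0 -> exists2 i, (i < 4)%N & #|radical g| = (q ^ (2 * i))%N.
Proof.
move=> /card_radical_le; have [i ->] := card_radical_exp g.
rewrite leq_exp2l ?(ltn_trans _ q_gt2) // => le_i; exists i => //; lia.
Qed.

(** The modulus of the sum comes from its square, and the sign is decided modulo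
    [q + 1], where [q] is congruent to [-1]. *)
Lemma expsum_radical g i : #|radical g| = (q ^ (2 * i))%N ->
  expsum g = (-1) ^+ (n + i) * (q ^ (n + i))%:Z.
Proof.
move=> rad_i; set k := (n + i)%N; have [t S_mod] := expsum_mod g.
have : expsum g ^+ 2 == ((-1) ^+ k * (q ^ k)%:Z) ^+ 2.
  rewrite expsum_sqr rad_i expm_eq -expnD exprMn sqrr_sign mul1r expr2 -PoszM -expnD.
  by apply/eqP; congr (Posz (_ ^ _)%N); rewrite /k; lia.
rewrite eqf_sqr => /orP[/eqP //|/eqP SN].
have [u def_u] : exists u : int, (-1) ^+ k * (q ^ k)%:Z = 1 + u * q.+1%:Z.
  elim: k {SN} => [|k [u IHk]]; first by exists 0; rewrite mul0r addr0 mul1r.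
  exists (1 - q%:Z * u - 1 - 1); rewrite exprS expnS PoszM mulrACA IHk -addn1 PoszD; ring.
have : (q.+1 %| 2)%N.
  suff : (q.+1%:Z %| 2)%Z by [].
  apply/dvdzP; exists (- t - u); have : expsum g + (-1) ^+ k * (q ^ k)%:Z = 0.
    by rewrite SN addNr.
  by rewrite def_u S_mod mulrBl mulNr => ?; lia.
by rewrite gtnNdvd // ltnS ltnW // q_gt2.
Qed.

(** * Power moments *)

Local Notation f1 x := (x ^+ (p ^ l).+1).
Local Notation f3 x := (x ^+ (p ^ (3 * l)).+1).

(** Expanding the power turns it into a character sum over tuples, which the hypothesis
    indexes by [I]; orthogonality does the rest. *)
Lemma sum_expsum_exp (I : finType) (h1 h2 : I -> F) k :
  (forall z g, p.-primitive_root z ->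
     (expsum g ^+ k)%:~R = \sum_i trace_char p m z (g.1 * h1 i + g.2 * h2 i)) ->
  \sum_g expsum g ^+ k =
  ((p ^ m) ^ 2 * #|[set i | (h1 i == 0) && (h2 i == 0)]|)%:Z.
Proof.
move=> expE; have [z z_prim] := C_prim_root_exists (prime_gt0 p_pr).
apply: (@intr_inj algC); rewrite rmorph_sum /= (eq_bigr _ (fun g _ => expE z g z_prim)).
by rewrite (sum_trace_char_pair p_pr cardF z_prim) cardF.
Qed.

Let frob_expS_eq0 k (x : F) : (x ^+ (p ^ k).+1 == 0) = (x == 0).
Proof. by rewrite expf_eq0. Qed.

Lemma sum_expsum1 : \sum_g expsum g = ((p ^ m) ^ 2)%:Z.
Proof.
under eq_bigr do rewrite -[expsum _]expr1.
rewrite (sum_expsum_exp (h1 := fun x => f1 x) (h2 := fun x => f3 x)) => [|z g z_prim].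
  rewrite (_ : [set _ | _] = [set 0]) ?cards1 ?muln1 //.
  by apply/setP => x; rewrite !inE !frob_expS_eq0 andbb.
by rewrite expr1 -(sum_trace_char_qarg g z_prim).
Qed.

(** [2 * d] is the greatest common divisor of [2 * l] and [m]. *)
Lemma subfield_of_square (x : F) : x ^+ (p ^ (2 * l)) = x -> x ^+ (p ^ (2 * d)) = x.
Proof.
move=> x2; have -> : (2 * d = gcdn (2 * l) m)%N; last first.
  by apply: frobenius_fixed_gcd; rewrite ?muln_gt0 // -cardF expf_card.
have cop : coprime n (l %/ d).
  apply: coprime_dvdl coprime_quotients; apply/dvdnP; exists 2%N.
  by rewrite mul2n halfK (negPf ml_even) subn0.
have -> : gcdn (2 * l) m = gcdn (l %/ d * (2 * d)) (n * (2 * d)).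
  by congr gcdn; [rewrite mulnCA -l_eq | rewrite {1}m_eq -mulnA (mulnC d)].
by rewrite -muln_gcdl [gcdn (l %/ d) n]gcdnC (eqP cop) mul1n.
Qed.

(** The first condition gives [u ^+ p ^ (2 * l) = u], so that [u] is in the subfield
    of order [q ^ 2], where both exponents reduce to [q + 1]. *)
Lemma norm_minus1 (u : F) : (f1 u == -1) && (f3 u == -1) = (u ^+ q.+1 == -1).
Proof.
have N1 : (-1 : F) ^+ q.-1 = 1.
  by rewrite -signr_odd -subn1 oddB ?q_gt0 // q_odd.
apply/andP/eqP => [[/eqP u1 _]|uq]; last first.
  by have uK := norm_in_subfield N1 uq; rewrite !exprS conj_l // conj_3l // -exprS uq eqxx.
have u_neq0 : u != 0 by apply: contra_eq_neq u1 => ->; rewrite expr0n eq_sym oppr_eq0 oner_eq0.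
have uK : u ^+ (p ^ (2 * d)) = u.
  apply: subfield_of_square; rewrite mulSn mul1n expnD exprM.
  have ul : u ^+ (p ^ l) = - u^-1.
    by apply: (mulfI u_neq0); rewrite -exprS u1 mulrN divff.
  by rewrite ul frobeniusN // exprVn ul invrN opprK invrK.
by rewrite -u1 !exprS conj_l.
Qed.

(** The nonzero solutions are the pairs [(x, u * x)] with [x != 0] and [u] of norm
    [-1]. *)
Lemma card_pair_zeros :
  #|[set xy : F * F | (f1 xy.1 + f1 xy.2 == 0) && (f3 xy.1 + f3 xy.2 == 0)]| =
  (1 + (p ^ m).-1 * q.+1)%N.
Proof.
rewrite -sum1dep_card.
rewrite -(pair_big_dep predT (fun x y => (f1 x + f1 y == 0) && (f3 x + f3 y == 0))
             (fun _ _ => 1%N)) /=.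
rewrite (bigD1 0) //= sum1dep_card (_ : [set _ | _] = [set 0]); last first.
  by apply/setP => y; rewrite !inE !expr0n /= !add0r !frob_expS_eq0 andbb.
rewrite cards1; congr (1 + _)%N.
rewrite (eq_bigr (fun=> q.+1)); first by rewrite sum_nat_const cardC1 cardF.
move=> x x_neq0; rewrite sum1dep_card.
rewrite -[RHS](@card_norm_fibre (-1)); last first.
  by rewrite -signr_odd -subn1 oddB ?q_gt0 // q_odd.
rewrite -[RHS](card_imset _ (mulIf x_neq0)); apply: eq_card => y.
have fibreE u : (f1 x + f1 (u * x) == 0) && (f3 x + f3 (u * x) == 0) = (u ^+ q.+1 == -1).
  rewrite -norm_minus1 !exprMn; congr (_ && _); rewrite -[X in X + _]mul1r -mulrDl mulf_eq0;
    by rewrite frob_expS_eq0 (negPf x_neq0) orbF addrC addr_eq0.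
rewrite [LHS]inE -[y](divfK x_neq0) fibreE; apply/idP/imsetP => [u1|[u]].
  by exists (y / x); rewrite ?inE.
by rewrite inE => u1 /(mulIf x_neq0) ->.
Qed.

Lemma sum_expsum2 : \sum_g expsum g ^+ 2 = ((p ^ m) ^ 2 * (1 + (p ^ m).-1 * q.+1))%:Z.
Proof.
rewrite (sum_expsum_exp (h1 := fun xy : F * F => f1 xy.1 + f1 xy.2)
           (h2 := fun xy : F * F => f3 xy.1 + f3 xy.2)) ?card_pair_zeros //.
move=> z g z_prim; rewrite rmorphXn /= expr2 -(sum_trace_char_qarg g z_prim).
rewrite mulr_suml -(pair_bigA _ (fun x y => trace_char p m z
  (g.1 * (f1 x + f1 y) + g.2 * (f3 x + f3 y)))) /=.
apply: eq_bigr => x _; rewrite mulr_sumr; apply: eq_bigr => y _.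
rewrite -(trace_charD p_pr cardF z_prim); congr trace_char; rewrite /qarg; ring.
Qed.

Lemma card_subfield : #|[set x : F | x ^+ (p ^ (2 * d)) == x]| = (q ^ 2)%N.
Proof.
rewrite (card_frobenius_fixed p_pr cardF) ?muln_gt0 ?delta_gt0 //.
  by rewrite mulnC expnM.
by rewrite {2}m_eq mulnC -mulnA dvdn_mull.
Qed.

(** [orthogonal_pairs] applies to the conjugates of [u] and [v] under [x ^+ p ^ l]: the
    missing orthogonality relations are conjugates of the first hypothesis. *)
Lemma isotropic_in_subfield (u v : F) :
  f1 u + f1 v + 1 = 0 -> f3 u + f3 v + 1 = 0 ->
  u ^+ (p ^ (2 * d)) = u /\ v ^+ (p ^ (2 * d)) = v.
Proof.
have frobS k (x : F) : x ^+ (p ^ (k * l)) ^+ (p ^ l) = x ^+ (p ^ (k.+1 * l)).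
  by rewrite -exprM -expnD -mulSnr.
have conj (a b c e : F) : a * b + c * e + 1 = 0 ->
    a ^+ (p ^ l) * b ^+ (p ^ l) + c ^+ (p ^ l) * e ^+ (p ^ l) + 1 = 0.
  move=> /(congr1 (fun x => x ^+ (p ^ l))) /=; rewrite !frobeniusD // !exprMn expr1n.
  by move=> ->; rewrite expr0n gtn_eqF // expn_gt0 prime_gt0.
have conj_neq0 (a b : F) : a != b -> a ^+ (p ^ l) != b ^+ (p ^ l).
  exact: contra_neq (@frobenius_inj F p l chF a b).
have frob2 (x : F) : x ^+ (p ^ l) ^+ (p ^ l) = x ^+ (p ^ (2 * l)).
  by rewrite -[RHS]frobS mul1n.
rewrite ![_ ^+ _.+1]exprSr => E01 E03; have E12 := conj _ _ _ _ E01.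
rewrite !frob2 in E12; have E23 := conj _ _ _ _ E12; rewrite !frob2 !frobS in E23.
have conj2 (x : F) : x ^+ (p ^ (2 * l)) != x -> x ^+ (p ^ (3 * l)) != x ^+ (p ^ l).
  by rewrite -[x ^+ (p ^ (3 * l))]frobS; apply: conj_neq0.
have [u2 v2] := orthogonal_pairs E01 E12 E23 E03 (conj2 u) (conj2 v).
by split; apply: subfield_of_square.
Qed.

Let norm_in_base (x : F) : x ^+ (p ^ (2 * d)) = x -> x ^+ q.+1 ^+ q = x ^+ q.+1.
Proof.
move=> xK; rewrite -exprM mulSn exprD -expnD addnn -mul2n xK.
by rewrite -exprSr.
Qed.

(** For each [u] in the subfield, the [v] with [v ^+ q.+1 = -1 - u ^+ q.+1] are
    [q + 1] in number, except that only [v = 0] remains when the norm of [u]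
    is [-1]. *)
Lemma card_hermitian_affine :
  #|[set uv : F * F | (f1 uv.1 + f1 uv.2 + 1 == 0) && (f3 uv.1 + f3 uv.2 + 1 == 0)]|
  = (q.+1 * (q ^ 2 - q))%N.
Proof.
rewrite -sum1dep_card.
rewrite -(pair_big_dep predT (fun x y => (f1 x + f1 y + 1 == 0) && (f3 x + f3 y + 1 == 0))
             (fun _ _ => 1%N)) /=.
have N1 : (-1 : F) ^+ q.-1 = 1.
  by rewrite -signr_odd -subn1 oddB ?q_gt0 // q_odd.
pose K := [set x : F | x ^+ (p ^ (2 * d)) == x].
pose K1 := [set x : F | x ^+ q.+1 == -1].
have card_K1 : #|K1| = q.+1 by apply: card_norm_fibre.
have K1K : K1 \subset K.
  by apply/subsetP => x; rewrite !inE => /eqP/(norm_in_subfield N1)->.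
have fibreE u : \sum_(v | (f1 u + f1 v + 1 == 0) && (f3 u + f3 v + 1 == 0)) 1%N =
    (if u \in K1 then 1 else if u \in K then q.+1 else 0)%N.
  have [uK|uNK] := boolP (u \in K); last first.
    have -> : (u \in K1) = false by apply: contraNF uNK; apply: (subsetP K1K).
    rewrite big_pred0 // => v; apply: contraNF uNK => /andP[/eqP E1 /eqP E3].
    by have [uK _] := isotropic_in_subfield E1 E3; rewrite inE uK.
  have {}uK : u ^+ (p ^ (2 * d)) = u by move: uK; rewrite inE => /eqP.
  pose b := - 1 - u ^+ q.+1.
  have bq : b ^+ q = b.
    rewrite /b frobeniusB // norm_in_base // frobeniusN // expr1n //.
  have b1 : b != 0 -> b ^+ q.-1 = 1 by move=> ?; apply: fixed_q_unity.
  have K_of_b (v : F) : v ^+ q.+1 = b -> v ^+ (p ^ (2 * d)) = v.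
    have [b0|/b1 b1'] := eqVneq b 0; last exact: norm_in_subfield.
    rewrite b0 => /eqP; rewrite expf_eq0 => /andP[_ /eqP ->].
    by rewrite expr0n gtn_eqF // expn_gt0 prime_gt0.
  have solE (v : F) : (f1 u + f1 v + 1 == 0) && (f3 u + f3 v + 1 == 0) = (v ^+ q.+1 == b).
    have normE (w : F) : w ^+ (p ^ (2 * d)) = w -> f1 w = w ^+ q.+1 /\ f3 w = w ^+ q.+1.
      by move=> wK; rewrite !exprS conj_l // conj_3l.
    have [fu1 fu3] := normE _ uK.
    have bE (w : F) : (u ^+ q.+1 + w + 1 == 0) = (w == b).
      by rewrite addrAC addrC addr_eq0 /b opprD addrC.
    apply/idP/eqP => [/andP[/eqP E1 /eqP E3]|vb].
      have [_ /normE[fv1 _]] := isotropic_in_subfield E1 E3.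
      by apply/eqP; rewrite -bE -fv1 -fu1 E1.
    have [fv1 fv3] := normE v (K_of_b v vb).
    by rewrite fu1 fu3 fv1 fv3 vb bE eqxx.
  rewrite (eq_bigl _ _ solE) sum1dep_card.
  have -> : (u \in K1) = (b == 0) by rewrite inE /b subr_eq0 eq_sym.
  case: eqVneq => [->|/b1 b1']; last exact: card_norm_fibre.
  rewrite -(cards1 (0 : F)); apply: eq_card => v.
  by rewrite !inE expf_eq0.
rewrite (eq_bigr _ (fun u _ => fibreE u)) (bigID (mem K1)) /=.
rewrite (eq_bigr (fun=> 1%N)) => [|u -> //]; rewrite sum1_card card_K1.
rewrite (eq_bigr (fun u => if u \in K then q.+1 else 0%N)) => [|u /negPf -> //].
rewrite -big_mkcondr /= (eq_bigl (fun u => u \in K :\: K1)) => [|u]; last by rewrite in_setD.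
rewrite sum_nat_const cardsDS // card_K1 card_subfield.
have q_lt : (q.+1 <= q ^ 2)%N by rewrite -mulnn; have := q_gt2; nia.
by nia.
Qed.

(** By homogeneity a solution with last coordinate [w != 0] is [w] times an affine point
    of the Hermitian curve over the subfield of order [q ^ 2], and a solution with last
    coordinate [0] comes from a point at infinity; [q ^ 3 + 1] is the number of points of
    the curve. *)
Lemma card_triple_zeros :
  #|[set t : F * F * F | (f1 t.1.1 + f1 t.1.2 + f1 t.2 == 0) &&
                         (f3 t.1.1 + f3 t.1.2 + f3 t.2 == 0)]|
  = (1 + (p ^ m).-1 * (q ^ 3).+1)%N.
Proof.
pose P w (uv : F * F) := (f1 uv.1 + f1 uv.2 + f1 w == 0) && (f3 uv.1 + f3 uv.2 + f3 w == 0).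
rewrite -sum1dep_card -(pair_big_dep predT (fun uv w => P w uv) (fun _ _ => 1%N)) //=.
rewrite (exchange_big_dep predT) //= (bigD1 0) //= sum1dep_card.
rewrite (_ : [set _ | _] = [set xy : F * F | (f1 xy.1 + f1 xy.2 == 0) &&
    (f3 xy.1 + f3 xy.2 == 0)]); last first.
  by apply/setP => uv; rewrite !inE /P !expr0n /= !addr0.
rewrite card_pair_zeros (eq_bigr (fun=> q.+1 * (q ^ 2 - q))%N).
  rewrite sum_nat_const cardC1 cardF -addnA -mulnDr; congr (_ + _ * _)%N.
  have q_lt : (q.+1 <= q ^ 2)%N by rewrite -mulnn; have := q_gt2; nia.
  by rewrite expnS; nia.
move=> w w_neq0; rewrite sum1dep_card -card_hermitian_affine.
have inj_w : injective (fun uv : F * F => (uv.1 * w, uv.2 * w)).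
  by move=> [u v] [u' v'] [/(mulIf w_neq0)-> /(mulIf w_neq0)->].
rewrite -[RHS](card_imset _ inj_w); apply: eq_card => uv.
have PE u v : P w (u * w, v * w) =
    (f1 u + f1 v + 1 == 0) && (f3 u + f3 v + 1 == 0).
  rewrite /P /= !exprMn -[X in _ + X == 0]mul1r -[X in _ && (_ + X == 0)]mul1r.
  by rewrite -!mulrDl !mulf_eq0 !frob_expS_eq0 (negPf w_neq0) !orbF.
rewrite [LHS]inE; apply/idP/imsetP => [Puv|[[u v]]].
  exists (uv.1 / w, uv.2 / w); last by rewrite /= !divfK //; case: (uv).
  by rewrite inE -PE !divfK // -surjective_pairing.
by rewrite inE -PE => Puv ->.
Qed.

Lemma sum_expsum3 : \sum_g expsum g ^+ 3 = ((p ^ m) ^ 2 * (1 + (p ^ m).-1 * (q ^ 3).+1))%:Z.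
Proof.
rewrite (sum_expsum_exp (h1 := fun t : F * F * F => f1 t.1.1 + f1 t.1.2 + f1 t.2)
  (h2 := fun t : F * F * F => f3 t.1.1 + f3 t.1.2 + f3 t.2)) ?card_triple_zeros //.
move=> z g z_prim; rewrite rmorphXn /= !exprS expr0 mulr1 -(sum_trace_char_qarg g z_prim).
rewrite mulr_suml -(pair_bigA _ (fun uv w => trace_char p m z
  (g.1 * (f1 uv.1 + f1 uv.2 + f1 w) + g.2 * (f3 uv.1 + f3 uv.2 + f3 w)))) /=.
rewrite -(pair_bigA _ (fun u v => \sum_w trace_char p m z
  (g.1 * (f1 u + f1 v + f1 w) + g.2 * (f3 u + f3 v + f3 w)))) /=.
apply: eq_bigr => x _; rewrite mulr_suml mulr_sumr; apply: eq_bigr => y _.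
rewrite mulrA mulr_sumr; apply: eq_bigr => w _.
rewrite -!(trace_charD p_pr cardF z_prim); congr trace_char; rewrite /qarg; ring.
Qed.

(** * The rank distribution *)

Definition corank_count (i : nat) : nat :=
  #|[set g : F * F | (g != 0) && (#|radical g| == q ^ (2 * i))%N]|.

Lemma sum_by_corank (R : nmodType) (G : F * F -> R) (u : nat -> R) :
  (forall g i, g != 0 -> (i < 4)%N -> #|radical g| = (q ^ (2 * i))%N -> G g = u i) ->
  \sum_g G g = G 0 + \sum_(i < 4) u i *+ corank_count i.
Proof.
move=> Gu; rewrite (bigD1 (0 : F * F)) //=; congr (_ + _).
rewrite (eq_bigr (fun g => \sum_(i < 4) if #|radical g| == (q ^ (2 * i))%N then u i else 0)).
  rewrite exchange_big; apply: eq_bigr => i _ /=.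
  rewrite -big_mkcondr sumr_const; congr (_ *+ _); apply: eq_card => g.
  by rewrite [RHS]inE.
move=> g g_neq0; have [i lt_i rad_i] := card_radical g_neq0.
rewrite (bigD1 (Ordinal lt_i)) //= rad_i eqxx (Gu g i) // big1 ?addr0 // => j neq_ji.
rewrite eqn_exp2l ?(ltn_trans _ q_gt2) // eqn_pmul2l //; case: eqP => // eq_ij.
by case/eqP: neq_ji; apply: val_inj.
Qed.

Lemma qform_zero x : qform 0 x = 0.
Proof. by rewrite /qform /qarg !mul0r addr0 abs_trace0. Qed.

Lemma qform_fibre_zero a : N 0 a = if a == 0 then (p ^ m)%N else 0%N.
Proof.
rewrite /N; have [->|a_neq0] := eqVneq a 0.
  rewrite -cardF -cardsT; congr #|pred_of_set _|; apply/setP => x.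
  by rewrite !inE qform_zero eqxx.
apply/eqP; rewrite cards_eq0; apply/eqP/setP => x.
by rewrite !inE qform_zero eq_sym (negPf a_neq0).
Qed.

Lemma expsum_zero : expsum 0 = (p ^ m)%:Z.
Proof. by rewrite /expsum !qform_fibre_zero eqxx oner_eq0 subr0. Qed.

Local Notation qr := (p%:R ^+ d : rat).
Local Notation X := (p%:R ^+ m./2 : rat).

Lemma expsum_rat g i : #|radical g| = (q ^ (2 * i))%N ->
  (expsum g)%:~R = eps m l * X * (- qr) ^+ i.
Proof.
move/expsum_radical->; rewrite rmorphM /= rmorphXn rmorphN rmorph1 /= /eps.
rewrite halfm_eq mulnC exprM -[(q ^ _)%:Z%:~R]/((q ^ (n + i))%:R) !natrX.
by rewrite !exprD (exprNn qr); ring.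
Qed.

Lemma exp_m_rat : (p ^ m)%:R = X ^+ 2 :> rat.
Proof. by rewrite natrX -exprM {1}m_eq halfm_eq. Qed.

Lemma corank_moment k :
  \sum_g (expsum g)%:~R ^+ k =
  X ^+ (2 * k) + (eps m l * X) ^+ k * \sum_(i < 4) (- qr) ^+ (i * k) * (corank_count i)%:R.
Proof.
rewrite (sum_by_corank (u := fun i => (eps m l * X * (- qr) ^+ i) ^+ k)).
  rewrite expsum_zero -[_%:~R]/((p ^ m)%:R) exp_m_rat (exprM X 2) mulr_sumr.
  congr (_ + _); apply: eq_bigr => i _.
  by rewrite exprMn (exprM _ i k) mulrA mulr_natr.
by move=> g i _ _ rad_i; rewrite (expsum_rat rad_i).
Qed.

(** The total number of forms and the first three power moments determine the rank
    distribution. *)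
Lemma Freq_corank i : (i < 4)%N -> Freq p m l i = (corank_count i)%:R.
Proof.
have X_neq0 : X != 0 by rewrite expf_neq0 // pnatr_eq0 -lt0n prime_gt0.
have eN0 : eps m l != 0 by rewrite /eps signr_eq0.
have int_moment k M : \sum_g expsum g ^+ k = M%:Z -> \sum_g (expsum g)%:~R ^+ k = M%:R :> rat.
  move=> SE; rewrite -[RHS]/(M%:Z%:~R) -SE rmorph_sum /=.
  by apply: eq_bigr => g _; rewrite rmorphXn.
have qE : q%:R = qr by rewrite natrX.
have moment k t : \sum_g (expsum g)%:~R ^+ k = X ^+ (2 * k) + (eps m l * X) ^+ k * t ->
    \sum_(i < 4) (- qr) ^+ (i * k) * (corank_count i)%:R = t.
  by rewrite corank_moment => /addrI/(mulfI (expf_neq0 _ (mulf_neq0 eN0 X_neq0))).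
have pred_m : (p ^ m).-1%:R = X ^+ 2 - 1 :> rat.
  by rewrite -subn1 natrB ?expn_gt0 ?prime_gt0 // exp_m_rat.
have e2 : eps m l ^+ 2 = 1 by rewrite /eps sqrr_sign.
move: i; apply: (@Freq_of_moments p m l (fun i => (corank_count i)%:R));
  rewrite ?prime_gt1 ?delta_gt0 //.
- by rewrite halfm_eq -m_eq.
- by rewrite halfm_eq leq_pmul2r ?delta_gt0 // halfdim_gt3.
- rewrite -[RHS](moment 0%N); first by rewrite !big_ord_recl big_ord0 /= /bump /=; ring.
  rewrite (eq_bigr (fun=> 1)) => [|g _]; last by rewrite expr0.
  rewrite sumr_const cardT -cardE card_prod cardF natrM exp_m_rat; ring.
- rewrite -[RHS](moment 1%N); first by rewrite !big_ord_recl big_ord0 /= /bump /=; ring.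
  rewrite (int_moment 1%N ((p ^ m) ^ 2)%N).
    rewrite natrX exp_m_rat; ring: e2.
  by under eq_bigr do rewrite expr1; rewrite sum_expsum1.
- rewrite -[RHS](moment 2%N); first by rewrite !big_ord_recl big_ord0 /= /bump /=; ring.
  rewrite (int_moment 2%N _ sum_expsum2) natrM natrX exp_m_rat natrD natrM pred_m.
  rewrite -[q.+1%:R]natr1 qE; ring: e2.
- rewrite -[RHS](moment 3%N); first by rewrite !big_ord_recl big_ord0 /= /bump /=; ring.
  rewrite (int_moment 3%N _ sum_expsum3) natrM natrX exp_m_rat natrD natrM pred_m.
  rewrite -[(q ^ 3).+1%:R]natr1 natrX qE; ring: e2.
Qed.

(** * Adding a linear form *)

Definition affine_fibre g (b : F) (a : 'F_p) : nat :=
  #|[set x | qform g x + Tr (b * x) == a]|.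

Local Notation polar_image g := [set polar g y | y : F].

Lemma polar_sym g u y : Tr (polar g u * y) = Tr (polar g y * u).
Proof.
apply: (addrI (qform g u + qform g y)); rewrite -qformD addrC qformD.
by rewrite [qform g y + _]addrC.
Qed.

(** Completing the square. *)
Lemma affine_fibre_polar g y a : affine_fibre g (polar g y) a = N g (a + qform g y).
Proof.
rewrite /affine_fibre /N -[LHS](card_imset _ (addIr y)); apply: eq_card => x.
have QE v : (qform g (v + y) == a + qform g y) = (qform g v + Tr (polar g y * v) == a).
  by rewrite qformD polar_sym addrAC (inj_eq (addIr _)).
rewrite [RHS]inE; apply/imsetP/idP => [[v]|Qx].
  by rewrite inE -QE => Qv ->.
by exists (x - y); rewrite ?subrK // inE -QE subrK.
Qed.

(** The image of the polarisation lies in the orthogonal of the radical, and both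
    have [p ^ m / #|radical g|] elements. *)
Lemma mem_polar_image g b :
  (forall u, u \in radical g -> Tr (b * u) = 0) -> b \in polar_image g.
Proof.
pose perp := [set b | [forall u in radical g, Tr (b * u) == 0]].
have perpP c : reflect (forall u, u \in radical g -> Tr (c * u) = 0) (c \in perp).
  rewrite inE; apply: (iffP forall_inP) => Tc u /Tc; first by move/eqP.
  by move->.
move/perpP; suff -> : perp = polar_image g by [].
apply/esym/eqP; rewrite eqEcard; apply/andP; split.
  apply/subsetP => _ /imsetP[y _ ->]; apply/perpP => u.
  by rewrite inE polar_sym => /eqP ->; rewrite mul0r abs_trace0.
have rad_gt0 : (0 < #|radical g|)%N by apply/card_gt0P; exists 0; apply: radical0.
rewrite -(leq_pmul2r rad_gt0) card_polar_image eq_leq //.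
have [z z_prim] := C_prim_root_exists (prime_gt0 p_pr).
apply/eqP; rewrite -(eqr_nat algC); apply/eqP.
transitivity (\sum_b \sum_(u in radical g) trace_char p m z (b * u)); last first.
  rewrite exchange_big /= (eq_bigr _ (fun u _ => sum_trace_char p_pr cardF z_prim u)).
  rewrite (bigD1 0) ?radical0 //= eqxx cardF big1 ?addr0 // => u /andP[_ /negPf ->] //.
rewrite natrM mulr_natl -sumr_const big_mkcond /=; apply: eq_bigr => c _.
have [cP|cNP] := boolP (c \in perp).
  rewrite -sumr_const; apply: eq_bigr => u u_rad.
  by rewrite /trace_char (perpP _ cP).
have [u0 u0_rad Tu0] : exists2 u0, u0 \in radical g & Tr (c * u0) != 0.
  move: cNP; rewrite inE => /forall_inPn/= [u0 ? ?]; by exists u0.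
set S := \sum_(u in _) _.
have chi1 : trace_char p m z (c * u0) != 1 by rewrite (Fp_char_eq1 p_pr z_prim).
have /eqP : trace_char p m z (c * u0) * S = S.
  rewrite mulr_sumr [RHS](reindex_inj (addrI u0)) /=.
  apply: eq_big => u.
    move: u0_rad; rewrite !inE polarD => /eqP ->; by rewrite add0r.
  by rewrite mulrDr (trace_charD p_pr cardF z_prim).
rewrite -subr_eq0 -[X in _ - X]mul1r -mulrBl mulf_eq0 subr_eq0.
by rewrite (negPf chi1) => /eqP.
Qed.

(** Translation by the radical makes the values equidistributed. *)
Lemma affine_fibre_balanced g b a :
  b \notin polar_image g -> (p * affine_fibre g b a = p ^ m)%N.
Proof.
move=> bN; have [u u_rad Tu] : exists2 u, u \in radical g & Tr (b * u) != 0.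
  suff /exists_inP[u ? ?] : [exists u in radical g, Tr (b * u) != 0] by exists u.
  apply: contraR bN => /exists_inPn/= Tu0.
  by apply: mem_polar_image => u /Tu0/negbNE/eqP.
have shift a' : affine_fibre g b a' = affine_fibre g b 0.
  have [->//|a'_neq0] := eqVneq a' 0.
  pose c := a' / Tr (b * u); have c_neq0 : c != 0 by rewrite mulf_neq0 ?invr_eq0.
  pose v := (c : nat)%:R * u.
  have v_rad : v \in radical g.
    apply: radical_stable u_rad; rewrite mulnC exprM fixed_q_unity ?expr1n //.
      by rewrite (Fp_natr_eq0 chF).
    by rewrite Fp_natr_frobenius.
  have Tv : Tr (b * v) = a' by rewrite /v mulrCA abs_traceZ // divfK.
  rewrite /affine_fibre -[RHS](card_imset _ (addIr v)); apply: eq_card => x.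
  have shiftE w : (qform g (w + v) + Tr (b * (w + v)) == a') =
      (qform g w + Tr (b * w) == 0).
    rewrite qformD polar_sym (qform_radical v_rad); move: v_rad; rewrite inE => /eqP ->.
    rewrite mul0r abs_trace0 // !addr0 mulrDr abs_traceD // Tv addrA.
    by rewrite -[X in _ == X]add0r (inj_eq (addIr _)).
  rewrite [LHS]inE; apply/idP/imsetP => [Qx|[w]].
    by exists (x - v); rewrite ?subrK // inE -shiftE subrK.
  by rewrite inE -shiftE => Qw ->.
have <- : (\sum_(a' : 'F_p) affine_fibre g b a' = p ^ m)%N.
  rewrite -cardF -[RHS]sum1_card (partition_big (fun x => qform g x + Tr (b * x)) predT) //=.
  by apply: eq_bigr => a' _; rewrite /affine_fibre sum1dep_card.
rewrite (eq_bigr (fun=> affine_fibre g b a)) => [|a' _]; last by rewrite !shift.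
by rewrite sum_nat_const card_Fp.
Qed.

(** * Weights of the codewords *)

Definition word (g : F * F) (b : F) (c : 'F_p) : {ffun {x : F | x != 0} -> ('F_p)^o} :=
  trace_word m ('X * Lpoly p l g + b *: 'X) c.

Lemma wordE g b c x : word g b c x = qform g (val x) + Tr (b * val x) + c.
Proof.
rewrite ffunE /Lpoly !hornerE -abs_traceD //; congr (Tr _ + _).
by rewrite /qarg !exprS; ring.
Qed.

Lemma word_linear (a : 'F_p) g g' b b' c c' :
  a *: word g b c + word g' b' c' =
  word ((a : nat)%:R * g.1 + g'.1, (a : nat)%:R * g.2 + g'.2)
       ((a : nat)%:R * b + b') (a * c + c').
Proof.
apply/ffunP => x; rewrite [LHS]ffunE [X in X + _]ffunE !wordE.
set y := val x; pose G := ((a : nat)%:R * g.1 + g'.1, (a : nat)%:R * g.2 + g'.2).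
have E : qform G y + Tr (((a : nat)%:R * b + b') * y) =
    a * (qform g y + Tr (b * y)) + (qform g' y + Tr (b' * y)).
  rewrite /qform -!abs_traceD // -abs_traceZ // -abs_traceD //; congr Tr.
  by rewrite /qarg /=; ring.
rewrite E.
transitivity (a * (qform g y + Tr (b * y) + c) + (qform g' y + Tr (b' * y) + c')) => //.
by rewrite [a * (_ + c)]mulrDr addrACA.
Qed.

(** The coordinate [0] is missing from the words; its value would be [c]. *)
Lemma hweight_word g b c :
  (hweight (word g b c) + (c != 0%R) + affine_fibre g b (- c)%R = p ^ m)%N.
Proof.
have wE : hweight (word g b c) = #|~: [set x | qform g x + Tr (b * x) == - c] :\ 0%R|.
  rewrite /hweight -(card_imset _ val_inj); apply: eq_card => x.
  rewrite !inE; apply/imsetP/andP => [[y]|[x_neq0 Qx]].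
    by rewrite inE wordE addr_eq0 => ? ->; split; first exact: valP y.
  by exists (Sub x x_neq0) => //; rewrite inE wordE addr_eq0.
have := cardsD1 0%R (~: [set x | qform g x + Tr (b * x) == - c]).
rewrite -wE !inE qform0 mulr0 abs_trace0 // addr0 eq_sym oppr_eq0 => wE'.
rewrite [(hweight _ + _)%N]addnC -wE' -cardF.
by rewrite -[RHS](cardsC [set x | qform g x + Tr (b * x) == - c]) addnC.
Qed.

Lemma affine_fibre0 g a : affine_fibre g 0 a = N g a.
Proof.
by have := affine_fibre_polar g 0 a; rewrite polar0 qform0 addr0.
Qed.

Local Notation pr := (p%:R : rat).

Let pr_neq0 : pr != 0. Proof. by rewrite pnatr_eq0 -lt0n prime_gt0. Qed.

Let pred_pr : p.-1%:R = pr - 1 :> rat.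
Proof. by rewrite -subn1 natrB ?prime_gt0. Qed.

Lemma hweight_rat g b c :
  (hweight (word g b c))%:R = X ^+ 2 - (c != 0)%:R - (affine_fibre g b (- c))%:R :> rat.
Proof. by rewrite -exp_m_rat -(hweight_word g b c) !natrD addrAC !addrK. Qed.

Lemma L0_weight_sum (f : rat -> rat) g :
  \sum_c f (hweight (word g 0 c))%:R =
  f (X ^+ 2 - (N g 0)%:R) + (pr - 1) * f (X ^+ 2 - 1 - (N g 1)%:R).
Proof.
rewrite (sum_Fp_const (u := f (X ^+ 2 - 1 - (N g 1)%:R))) => [|c c_neq0].
  by rewrite hweight_rat eqxx subr0 affine_fibre0 oppr0 -[X in _ + X]mulr_natl pred_pr.
by rewrite hweight_rat c_neq0 affine_fibre0 qform_fibre_const ?oppr_eq0.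
Qed.

(** After completing the square, the word of constant [c] counts the fibre over
    [qform g y - c], and [c = 0] and [c = qform g y] are the two exceptional constants. *)
Let square_sum (f : rat -> rat) g y :
  \sum_c f (hweight (word g (polar g y) c))%:R =
  if qform g y == 0 then f (X ^+ 2 - (N g 0)%:R) + (pr - 1) * f (X ^+ 2 - 1 - (N g 1)%:R)
  else f (X ^+ 2 - (N g 1)%:R) + f (X ^+ 2 - 1 - (N g 0)%:R)
       + (pr - 2) * f (X ^+ 2 - 1 - (N g 1)%:R).
Proof.
have wE c : (hweight (word g (polar g y) c))%:R =
    X ^+ 2 - (c != 0)%:R - (N g (qform g y - c))%:R :> rat.
  by rewrite hweight_rat affine_fibre_polar [- c + _]addrC.
case: eqVneq => [Qy|Qy].
  rewrite (sum_Fp_const (u := f (X ^+ 2 - 1 - (N g 1)%:R))) => [|c c_neq0].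
    by rewrite wE eqxx Qy !subr0 -[X in _ + X]mulr_natl pred_pr.
  by rewrite wE c_neq0 Qy qform_fibre_const ?sub0r ?oppr_eq0.
rewrite (bigD1 0) //= (bigD1 (qform g y)) //= (eq_bigr (fun=> f (X ^+ 2 - 1 - (N g 1)%:R))).
  rewrite !wE eqxx Qy subrr !subr0 qform_fibre_const // sumr_const -[RHS]addrA.
  congr (_ + (_ + _)); rewrite -[LHS]mulr_natl; congr (_ * _).
  have -> : #|[pred c : 'F_p | (c != 0) && (c != qform g y)]| = (p - 2)%N.
    rewrite -[X in (X - _)%N](card_Fp p_pr) -(cardC (pred2 0 (qform g y))) card2.
    by rewrite eq_sym Qy addKn; apply: eq_card => c; rewrite !inE negb_or.
  by rewrite natrB // prime_gt1.
move=> c /andP[c_neq0 c_neqQ]; rewrite wE c_neq0 qform_fibre_const //.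
by rewrite subr_eq0 eq_sym.
Qed.

(** The first summand comes from the linear forms outside the image of the polarisation,
    which give balanced values.  In the others [n0 / r] and [n1 / r] are, by [sum_polar],
    the numbers of linear forms in the image that correspond to a given value
    of [qform g y]. *)
Lemma L2_weight_sum (f : rat -> rat) g :
  let r := (#|radical g|%:R : rat) in
  let n0 : rat := (N g 0)%:R in let n1 : rat := (N g 1)%:R in
  \sum_b \sum_c f (hweight (word g b c))%:R =
  (X ^+ 2 - X ^+ 2 / r) * (f (X ^+ 2 - X ^+ 2 / pr)
                           + (pr - 1) * f (X ^+ 2 - 1 - X ^+ 2 / pr))
  + n0 / r * (f (X ^+ 2 - n0) + (pr - 1) * f (X ^+ 2 - 1 - n1))
  + (pr - 1) * (n1 / r) * (f (X ^+ 2 - n1) + f (X ^+ 2 - 1 - n0)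
                           + (pr - 2) * f (X ^+ 2 - 1 - n1)).
Proof.
move=> r n0 n1; rewrite (bigID (fun b => b \in polar_image g)) /= addrC -addrA.
have r_neq0 : r != 0.
  by rewrite pnatr_eq0 -lt0n; apply/card_gt0P; exists 0; apply: radical0.
have card_im : #|polar_image g|%:R = X ^+ 2 / r :> rat.
  by apply: (canRL (mulfK r_neq0)); rewrite -natrM card_polar_image exp_m_rat.
congr (_ + _).
  rewrite (eq_bigr (fun=> f (X ^+ 2 - X ^+ 2 / pr) + (pr - 1) * f (X ^+ 2 - 1 - X ^+ 2 / pr))).
    rewrite sumr_const -[LHS]mulr_natl; congr (_ * _).
    rewrite -card_im -exp_m_rat -cardF -(cardC (mem (polar_image g))).
    rewrite natrD [_%:R + _]addrC addrK.
    by congr (_%:R); apply: eq_card => b; rewrite !inE.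
  move=> b bN; have af a : (affine_fibre g b a)%:R = X ^+ 2 / pr :> rat.
    apply: (canRL (mulfK pr_neq0)).
    by rewrite mulrC -natrM affine_fibre_balanced // exp_m_rat.
  rewrite (sum_Fp_const (u := f (X ^+ 2 - 1 - X ^+ 2 / pr))) => [|c c_neq0].
    by rewrite hweight_rat af eqxx subr0 -[X in _ + X]mulr_natl pred_pr.
  by rewrite hweight_rat af c_neq0.
apply: (mulIf r_neq0); rewrite /r mulr_natr -sum_polar.
under eq_bigr do rewrite square_sum.
rewrite (sum_qform (fun a => if a == 0 then _ else _)) (sum_Fp_const (u :=
  (f (X ^+ 2 - n1) + f (X ^+ 2 - 1 - n0) + (pr - 2) * f (X ^+ 2 - 1 - n1)) * n1)).
  rewrite eqxx -mulr_natr -[X in _ + X]mulr_natr pred_pr -/n0 -/n1 -/r.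
  by field.
by move=> a a_neq0; rewrite (negPf a_neq0) (qform_fibre_const g a_neq0) -[LHS]mulr_natr.
Qed.

(** * Bounds for the fibres *)

Lemma qform_fibre_rat g (S := (expsum g)%:~R : rat) :
  (N g 0)%:R = (X ^+ 2 + (pr - 1) * S) / pr /\ (N g 1)%:R = (X ^+ 2 - S) / pr.
Proof.
have SE : S = (N g 0)%:R - (N g 1)%:R by rewrite /S /expsum rmorphB.
rewrite -exp_m_rat -(qform_fibre_sum g) natrD natrM pred_pr SE.
by split; apply: (canRL (mulfK pr_neq0)); ring.
Qed.

Let pr_ge3 : 3 <= pr. Proof. by rewrite ler_nat odd_prime_gt2. Qed.

Let pr_le_qr : pr <= qr.
Proof. by rewrite -natrX ler_nat -{1}(expn1 p) leq_exp2l ?prime_gt1 ?delta_gt0. Qed.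

Let qr_ge3 : 3 <= qr. Proof. exact: le_trans pr_le_qr. Qed.

Let qr4_le_X : qr ^+ 4 <= X.
Proof.
rewrite -!natrX ler_nat -expnM leq_exp2l ?prime_gt1 // halfm_eq mulnC.
by rewrite leq_pmul2r ?delta_gt0 // halfdim_gt3.
Qed.

Let X_ge1 : 1 <= X.
Proof. by rewrite -natrX ler1n expn_gt0 prime_gt0. Qed.

Let epsE : eps m l = if odd n then -1 else 1.
Proof. by rewrite /eps -signr_odd; case: odd. Qed.

(** The size of the largest fibre of a nonzero form.  It occurs at corank [3], where the
    sum is [- eps m l * qr ^+ 3 * X]: over the nonzero values if this is negative,
    over [0] if it is positive. *)
Definition fibre_max : rat :=
  if odd n then (X ^+ 2 + (pr - 1) * qr ^+ 3 * X) / pr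
  else (X ^+ 2 + qr ^+ 3 * X) / pr.

(** For odd [n] the fibres over nonzero values stay strictly below the maximum; this is
    why the minimum distances of the two codes then differ by [1]. *)
Lemma qform_fibre_bounds g : g != 0 ->
  (N g 0)%:R <= fibre_max /\ (N g 1)%:R <= fibre_max - (odd n)%:R.
Proof.
move=> g_neq0; have [i lt_i rad_i] := card_radical g_neq0.
have q_ge1 : 1 <= qr by apply: le_trans qr_ge3.
have X_ge0 : 0 <= X by apply: le_trans X_ge1.
have B := alternating_power_bounds q_ge1 X_ge0 lt_i.
have [N0E N1E] := qform_fibre_rat g; rewrite N0E N1E (expsum_rat rad_i) epsE.
have [B0 B1 B2 B3] := fibre_bounds pr_ge3 pr_le_qr X_ge1 B.
rewrite /fibre_max; case: odd; last by rewrite mul1r subr0.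
by rewrite mulN1r mulNr mulrN opprK.
Qed.

Lemma qform_fibre_le g a : g != 0 -> (N g a)%:R <= fibre_max.
Proof.
move=> g_neq0; have [le0 le1] := qform_fibre_bounds g_neq0.
have [->//|a_neq0] := eqVneq a 0; rewrite qform_fibre_const // (le_trans le1) //.
by rewrite lerBlDr lerDl ler0n.
Qed.

Lemma balanced_le_fibre_max : X ^+ 2 / pr <= fibre_max.
Proof.
have q3X : 0 <= qr ^+ 3 * X.
  by rewrite mulr_ge0 ?exprn_ge0 ?(le_trans _ qr_ge3) ?(le_trans _ X_ge1).
have p_ge1 : 0 <= pr - 1 by rewrite subr_ge0 (le_trans _ pr_ge3).
rewrite /fibre_max; case: odd; rewrite ler_wpM2r ?invr_ge0 ?ler0n // lerDl //.
by rewrite -mulrA mulr_ge0.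
Qed.

Lemma affine_fibre_le g b c : (g, b, c) != 0 ->
  (affine_fibre g b (- c))%:R <= fibre_max.
Proof.
move=> t_neq0; have [b_im|bN] := boolP (b \in polar_image g); last first.
  rewrite (_ : _%:R = X ^+ 2 / pr) ?balanced_le_fibre_max //.
  apply: (canRL (mulfK pr_neq0)).
  by rewrite mulrC -natrM affine_fibre_balanced // exp_m_rat.
case/imsetP: b_im t_neq0 => y _ ->; rewrite affine_fibre_polar.
have [->|g_neq0 _] := eqVneq g 0; last exact: qform_fibre_le.
have -> : polar 0 y = 0.
  apply: (abs_trace_nondeg p_pr cardF) => u.
  by have := qformD 0 y u; rewrite !qform_zero !add0r => /esym.
move=> c_neq0; have {}c_neq0 : c != 0 by apply: contraNneq c_neq0 => ->.
rewrite qform_zero addr0 qform_fibre_zero oppr_eq0 (negPf c_neq0).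
rewrite (le_trans _ balanced_le_fibre_max) // divr_ge0 ?ler0n //.
by rewrite exprn_ge0 ?(le_trans _ X_ge1).
Qed.

Lemma fibre_max_lt : fibre_max < X ^+ 2 - 1.
Proof.
have [even_lt odd_lt] := fibre_bound_lt pr_ge3 pr_le_qr qr4_le_X.
by rewrite /fibre_max; case: odd.
Qed.

Let fibre_max_ge1 : 1 <= fibre_max.
Proof.
apply: le_trans balanced_le_fibre_max; rewrite ler_pdivlMr ?mul1r.
  2: by rewrite (lt_le_trans _ pr_ge3).
rewrite (le_trans pr_le_qr) // (le_trans (_ : qr <= X)) //; last by rewrite ler_eXnr.
by rewrite (le_trans _ qr4_le_X) // ler_eXnr // (le_trans _ qr_ge3).
Qed.

Lemma hweight_ge_L2 g b c : (g, b, c) != 0 ->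
  X ^+ 2 - 1 - fibre_max <= (hweight (word g b c))%:R.
Proof.
move=> t_neq0; rewrite hweight_rat; have := affine_fibre_le t_neq0.
by case: eqVneq => _ /=; lra.
Qed.

Lemma hweight_ge_L0 g c : (g, c) != 0 ->
  X ^+ 2 - 1 - fibre_max + (odd n)%:R <= (hweight (word g 0 c))%:R.
Proof.
move=> t_neq0; rewrite hweight_rat affine_fibre0.
have odd_le1 : (odd n)%:R <= 1 :> rat by rewrite lern1; case: odd.
have [g0|g_neq0] := eqVneq g 0.
  have c_neq0 : c != 0 by apply: contraNneq t_neq0 => ->; rewrite g0.
  rewrite g0 qform_fibre_zero oppr_eq0 (negPf c_neq0) subr0.
  by have := fibre_max_ge1; rewrite /= mulr1n; lra.
have [le0 le1] := qform_fibre_bounds g_neq0.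
have [->|c_neq0] := eqVneq c 0; first by rewrite subr0 oppr0; lra.
by rewrite qform_fibre_const ?oppr_eq0 //=; lra.
Qed.

(** The difference of two sets of parameters of the same word gives the zero word, and
    nonzero parameters give a positive weight. *)
Lemma word_inj g b c g' b' c' : word g b c = word g' b' c' -> (g, b, c) = (g', b', c').
Proof.
move=> eq_w; have := word_linear (-1) g' g b' b c' c.
rewrite eq_w scaleN1r addNr (Fp_natrN1 chF) !mulN1r ![- _ + _]addrC => /esym w0.
apply/eqP; rewrite -subr_eq0; apply: contraT => t_neq0.
have : (g - g', b - b', c - c') != 0 by [].
rewrite [g - g']surjective_pairing => /hweight_ge_L2.
rewrite w0 (_ : hweight _ = 0%N); last by apply/eqP; rewrite hweight_eq0.
by have := fibre_max_lt; lra.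
Qed.

(** * The codes *)

Lemma code_L0E : code_L0 p m l F = [set word t.1 0 t.2 | t : (F * F) * 'F_p].
Proof.
have wE g c : trace_word m ('X * Lpoly p l g) c = word g 0 c.
  by rewrite /word scale0r addr0.
apply/setP => w; apply/imset2P/imsetP => [[g c _ _ ->]|[[g c] _ ->]].
  by exists (g, c); rewrite ?wE.
by exists g c; rewrite ?wE.
Qed.

Lemma code_L2E : code_L2 p m l F = [set word t.1.1 t.1.2 t.2 | t : (F * F) * F * 'F_p].
Proof.
apply/setP => w; apply/imset2P/imsetP => [[h c _ _ ->]|[[h c] _ ->]].
  by exists (h, c).
by exists h c.
Qed.

Let word0_inj : injective (fun t : (F * F) * 'F_p => word t.1 0 t.2).
Proof. by move=> [g c] [g' c'] /word_inj[-> ->]. Qed.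

Let word2_inj : injective (fun t : (F * F) * F * 'F_p => word t.1.1 t.1.2 t.2).
Proof. by move=> [[g b] c] [[g' b'] c'] /word_inj[-> -> ->]. Qed.

Lemma word0 : word 0 0 0 = 0.
Proof.
apply/ffunP => x; rewrite wordE ffunE qform_zero mul0r abs_trace0 // !addr0 //.
Qed.

Lemma card_coordinates : #|{: {x : F | x != 0}}| = (p ^ m - 1)%N.
Proof. by rewrite card_sig cardC1 cardF subn1. Qed.

Let dmin0 : rat := X ^+ 2 - 1 - fibre_max + (odd n)%:R.
Let dmin2 : rat := X ^+ 2 - 1 - fibre_max.

Let halfm_gt0 : (0 < m./2)%N.
Proof. by rewrite halfm_eq muln_gt0 delta_gt0 andbT (leq_trans _ halfdim_gt3). Qed.

Let pow_pred k a c : (k + 1 = a * m./2 + c * d)%N -> pr ^+ k = X ^+ a * qr ^+ c / pr.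
Proof.
move=> kE; apply: (canRL (mulfK pr_neq0)).
by rewrite -exprSr -addn1 kE exprD !(mulnC _ m./2) !(mulnC _ d) !exprM.
Qed.

Let dmin_L0_rat : (dmin_L0 p m l)%:R = dmin0.
Proof.
have m2 : m = (m./2 * 2)%N by rewrite halfm_eq -m_eq.
have pE : (p ^ (m - 1))%:R = X ^+ 2 / pr.
  rewrite natrX (@pow_pred _ 2 0) ?expr0 ?mulr1 //.
  by rewrite subnK ?card_field_exp_gt0 // mulnC -m2 addn0.
have eE : (p ^ (m./2 + 3 * d - 1))%:R = qr ^+ 3 * X / pr.
  by rewrite natrX (@pow_pred _ 1 3) ?expr1 1?[X * _]mulrC // mul1n subnK // ltn_addr.
pose d' := (if odd n then (p - 1) * p ^ (m./2 + 3 * d - 1) else p ^ (m./2 + 3 * d - 1) + 1)%N.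
have d'E : dmin0 = X ^+ 2 / pr * (pr - 1) - d'%:R.
  rewrite /dmin0 /d' /fibre_max; case: odd => /=.
    by rewrite natrM natrB ?prime_gt0 // eE; field.
  by rewrite natrD eE; field.
have mE : (p ^ (m - 1) * (p - 1))%:R = X ^+ 2 / pr * (pr - 1).
  by rewrite natrM pE natrB ?prime_gt0.
rewrite /dmin_L0 -/d' natrB ?mE -?d'E // -(ler_nat rat) mE -subr_ge0 -d'E.
by rewrite addr_ge0 ?ler0n // subr_ge0 ltW // fibre_max_lt.
Qed.

Let dmin_L2_rat : (dmin_L2 p m l)%:R = dmin2.
Proof.
rewrite /dmin_L2 /dmin2; have := dmin_L0_rat; rewrite /dmin0.
case: odd => /= [dE|->]; last exact: addr0.
rewrite natrB ?dE ?addrK //.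
by rewrite -(ler_nat rat) dE -subr_ge0 addrK subr_ge0 ltW ?fibre_max_lt.
Qed.

Lemma exists_corank3 : exists g, (expsum g)%:~R = eps m l * X * (- qr) ^+ 3 /\ g != 0.
Proof.
have : corank_count 3 != 0%N.
  rewrite -(eqr_nat rat) -Freq_corank //.
  apply: Freq3_neq0; rewrite ?prime_gt1 ?delta_gt0 //.
    by rewrite halfm_eq -m_eq.
  by rewrite halfm_eq leq_pmul2r ?delta_gt0 // halfdim_gt3.
rewrite -lt0n => /card_gt0P[g]; rewrite inE => /andP[g_neq0 /eqP rad_g].
by exists g; rewrite (expsum_rat rad_g).
Qed.

(** The index is [1] for even [n] and [0] for odd [n]: the value over which a form of
    corank [3] has its largest fibre.  The point [y] serves to reach this fibre from a
    nonzero constant by completing the square. *)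
Lemma exists_min_word : exists g,
  (N g (~~ odd n)%:R)%:R = fibre_max /\ exists y, qform g y != 0.
Proof.
have [g [SE g_neq0]] := exists_corank3; exists g.
have [N0E N1E] := qform_fibre_rat g; rewrite SE epsE in N0E N1E.
have q3N : (- qr) ^+ 3 = - qr ^+ 3 by ring.
split.
  rewrite /fibre_max; case: (odd n) N0E N1E => /= N0E N1E;
    by rewrite ?N0E ?N1E q3N; congr (_ / _); ring.
suff : N g 1 != 0%N.
  rewrite -lt0n => /card_gt0P[y]; rewrite inE => /eqP Qy; exists y.
  by rewrite Qy oner_eq0.
rewrite -(eqr_nat rat) N1E q3N.
have -> : X ^+ 2 - (if odd n then -1 else 1) * X * - qr ^+ 3 =
    X * (X + (if odd n then - qr ^+ 3 else qr ^+ 3)) by case: odd; ring.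
have X_gt0 : 0 < X by apply: lt_le_trans X_ge1.
have q3_gt0 : 0 < qr ^+ 3 by rewrite exprn_gt0 // (lt_le_trans _ qr_ge3).
have q3_lt : qr ^+ 3 < X.
  by rewrite (lt_le_trans _ qr4_le_X) // exprS ltr_pMl // (lt_le_trans _ qr_ge3).
rewrite mulf_neq0 ?invr_eq0 // mulf_neq0 ?lt0r_neq0 //.
by case: odd; rewrite ?subr_gt0 // addr_gt0.
Qed.

Lemma is_code_L0 : is_code (p ^ m - 1)%N (2 * m + 1)%N (dmin_L0 p m l) (code_L0 p m l F).
Proof.
rewrite code_L0E -card_coordinates; apply: is_code_of_submodule.
- by apply/imsetP; exists (0, 0); rewrite ?word0.
- move=> a _ _ /imsetP[[g c] _ ->] /imsetP[[g' c'] _ ->] /=.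
  rewrite word_linear mulr0 addr0; apply/imsetP.
  by exists (((a : nat)%:R * g.1 + g'.1, (a : nat)%:R * g.2 + g'.2), a * c + c').
- rewrite card_imset // !card_prod card_Fp // cardF addnC mulnC expnS.
  by congr (_ * _)%N; rewrite -expnD addnn mul2n.
- have [g [Nmax [y Qy]]] := exists_min_word.
  pose c : 'F_p := - (~~ odd n)%:R.
  have wE : (hweight (word g 0 c))%:R = dmin0.
    rewrite hweight_rat affine_fibre0 /c opprK Nmax /dmin0 oppr_eq0.
    by case: odd => /=; rewrite ?eqxx ?oner_eq0 /=; ring.
  exists (word g 0 c); first by apply/imsetP; exists (g, c).
  have -> : hweight (word g 0 c) == dmin_L0 p m l by rewrite -(eqr_nat rat) wE dmin_L0_rat.
  rewrite andbT -hweight_eq0 -(eqr_nat rat) wE gt_eqF // /dmin0.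
  by rewrite ltr_wpDr ?ler0n // subr_gt0 fibre_max_lt.
- move=> _ /imsetP[[g c] _ ->] w_neq0 /=; rewrite -(ler_nat rat) dmin_L0_rat.
  by apply: hweight_ge_L0; apply: contraNneq w_neq0 => -[-> ->]; rewrite /= word0.
Qed.

Lemma is_code_L2 : is_code (p ^ m - 1)%N (3 * m + 1)%N (dmin_L2 p m l) (code_L2 p m l F).
Proof.
rewrite code_L2E -card_coordinates; apply: is_code_of_submodule.
- by apply/imsetP; exists (0, 0, 0); rewrite ?word0.
- move=> a _ _ /imsetP[[[g b] c] _ ->] /imsetP[[[g' b'] c'] _ ->] /=.
  rewrite word_linear; apply/imsetP.
  by exists (((a : nat)%:R * g.1 + g'.1, (a : nat)%:R * g.2 + g'.2),
             (a : nat)%:R * b + b', a * c + c').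
- rewrite card_imset // !card_prod card_Fp // cardF addnC mulnC expnS.
  by congr (_ * _)%N; rewrite -!expnD addnn -mul2n -mulSnr.
- have [g [Nmax [y Qy]]] := exists_min_word.
  pose b := if odd n then polar g y else 0.
  pose c : 'F_p := if odd n then qform g y else -1.
  have wE : (hweight (word g b c))%:R = dmin2.
    rewrite hweight_rat /b /c /dmin2; case: odd Nmax => /= Nmax.
      by rewrite affine_fibre_polar addNr Qy Nmax.
    by rewrite affine_fibre0 opprK oppr_eq0 oner_eq0 Nmax.
  exists (word g b c); first by apply/imsetP; exists (g, b, c).
  have -> : hweight (word g b c) == dmin_L2 p m l by rewrite -(eqr_nat rat) wE dmin_L2_rat.
  by rewrite andbT -hweight_eq0 -(eqr_nat rat) wE gt_eqF // /dmin2 subr_gt0 fibre_max_lt.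
- move=> _ /imsetP[[[g b] c] _ ->] w_neq0 /=; rewrite -(ler_nat rat) dmin_L2_rat.
  by apply: hweight_ge_L2; apply: contraNneq w_neq0 => -[-> -> ->]; rewrite /= word0.
Qed.

(** * Weight distributions *)

(** The exponential sum and the sizes of the fibres at corank [i]. *)
Definition corank_sum (i : nat) : rat := eps m l * X * (- qr) ^+ i.
Definition zero_fibre i : rat := (X ^+ 2 + (pr - 1) * corank_sum i) / pr.
Definition nonzero_fibre i : rat := (X ^+ 2 - corank_sum i) / pr.

Lemma corank_fibres g i : #|radical g| = (q ^ (2 * i))%N ->
  (N g 0)%:R = zero_fibre i /\ (N g 1)%:R = nonzero_fibre i.
Proof.
by move=> rad_i; have := qform_fibre_rat g; rewrite (expsum_rat rad_i).
Qed.

Let d4_le : (4 * d <= m./2)%N.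
Proof. by rewrite halfm_eq leq_pmul2r ?delta_gt0 // halfdim_gt3. Qed.

Let m2E : m = (m./2 * 2)%N. Proof. by rewrite halfm_eq -m_eq. Qed.

Let pow_m : pr ^+ m = X ^+ 2.
Proof. by rewrite {1}m2E exprM. Qed.

Let pow_m1 : pr ^+ (m - 1) = X ^+ 2 / pr.
Proof.
rewrite (@pow_pred _ 2 0) ?expr0 ?mulr1 //.
by rewrite subnK ?card_field_exp_gt0 // mulnC -m2E addn0.
Qed.

Let pow_hi (i : nat) : pr ^+ (m./2 + i * d - 1) = X * qr ^+ i / pr.
Proof. by rewrite (@pow_pred _ 1 i) ?expr1 // mul1n subnK // ltn_addr. Qed.

Let entry0 (i : nat) :
  pr ^+ m - pr ^+ (m - 1) + (-1) ^+ i.+1 * eps m l * (pr - 1) * pr ^+ (m./2 + i * d - 1)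
  = X ^+ 2 - zero_fibre i.
Proof.
rewrite pow_m pow_m1 pow_hi /zero_fibre /corank_sum (exprNn qr) (exprS (-1)).
by field.
Qed.

Let entry1 (i : nat) :
  pr ^+ m - pr ^+ (m - 1) + (-1) ^+ i * eps m l * pr ^+ (m./2 + i * d - 1)
  = X ^+ 2 - nonzero_fibre i.
Proof.
rewrite pow_m pow_m1 pow_hi /nonzero_fibre /corank_sum (exprNn qr).
by field.
Qed.

Lemma weight_distribution_L0 : weight_distribution (code_L0 p m l F) (table_L0 p m l).
Proof.
move=> w; rewrite code_L0E (card_image_count _ _ word0_inj) sum_table.
pose f (x : rat) : rat := (x == w)%:R.
rewrite -(pair_bigA _ (fun g c => f (hweight (word g 0 c))%:R)) /=.
under eq_bigr do rewrite L0_weight_sum.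
rewrite (sum_by_corank (u := fun i => f (X ^+ 2 - zero_fibre i)
    + (pr - 1) * f (X ^+ 2 - 1 - nonzero_fibre i))); last first.
  by move=> g i _ _ /corank_fibres[-> ->].
rewrite /table_L0 big_cat big_flatten big_map big_cons big_seq1.
rewrite -[iota 0 4]/(index_iota 0 4) big_mkord; congr (_ + _).
  rewrite !qform_fibre_zero eqxx (oner_eq0 _) exp_m_rat subrr subr0 pow_m -!/(f _).
  by rewrite mulr1 [f _ * _]mulrC.
apply: eq_bigr => i _; rewrite !big_cons big_nil /= addr0 -!/(f _).
rewrite entry0 entry1 -[LHS]mulr_natr -Freq_corank //.
by rewrite [X ^+ 2 - 1 - _]addrAC; ring.
Qed.

Let pow_low a b (i : 'I_4) : (b * i <= a * 4)%N ->
  pr ^+ (a * m./2 - b * i * d) = X ^+ a / qr ^+ (b * i).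
Proof.
move=> le_ba; have qr_neq0 : qr != 0 by rewrite expf_neq0.
apply: (canRL (mulfK (expf_neq0 _ qr_neq0))).
rewrite -!exprM -exprD (mulnC d) subnK; first by rewrite mulnC.
rewrite (leq_trans _ (leq_mul (leqnn a) d4_le)) // mulnA.
by rewrite leq_mul2r le_ba orbT.
Qed.

Let pow_low_pred a b (i : 'I_4) : (b * i < a * 4)%N ->
  pr ^+ (a * m./2 - b * i * d - 1) = X ^+ a / qr ^+ (b * i) / pr.
Proof.
move=> lt_ba; rewrite -pow_low; last exact: ltnW.
apply: (canRL (mulfK pr_neq0)); rewrite -exprSr -addn1 subnK // subn_gt0.
rewrite (@leq_trans (a * (4 * d))) ?leq_mul2l ?d4_le ?orbT //.
by rewrite mulnA ltn_pmul2r ?delta_gt0.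
Qed.

Let pow_m2i (i : 'I_4) : pr ^+ (m - 2 * i * d) = X ^+ 2 / qr ^+ (2 * i).
Proof.
have := @pow_low 2 2 i; rewrite (mulnC 2 m./2) -m2E => -> //.
by rewrite leq_mul2l ltnW.
Qed.

Let pow_m2i_pred (i : 'I_4) : pr ^+ (m - 2 * i * d - 1) = X ^+ 2 / qr ^+ (2 * i) / pr.
Proof.
have := @pow_low_pred 2 2 i; rewrite (mulnC 2 m./2) -m2E => -> //.
by rewrite ltn_mul2l ltn_ord.
Qed.

Let pow_hi_low (i : 'I_4) : pr ^+ (m./2 - i * d - 1) = X / qr ^+ i / pr.
Proof.
have := @pow_low_pred 1 1 i; rewrite !mul1n expr1 => -> //.
Qed.

Lemma weight_distribution_L2 : weight_distribution (code_L2 p m l F) (table_L2 p m l).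
Proof.
move=> w; rewrite code_L2E (card_image_count _ _ word2_inj) sum_table.
pose f (x : rat) : rat := (x == w)%:R.
rewrite -(pair_bigA _ (fun gb c => f (hweight (word gb.1 gb.2 c))%:R)) /=.
rewrite -(pair_bigA _ (fun g b => \sum_c f (hweight (word g b c))%:R)) /=.
under eq_bigr do rewrite L2_weight_sum.
pose A := f (X ^+ 2 - X ^+ 2 / pr) + (pr - 1) * f (X ^+ 2 - 1 - X ^+ 2 / pr).
pose u i : rat := let n0 := zero_fibre i in let n1 := nonzero_fibre i in
  (X ^+ 2 - X ^+ 2 / qr ^+ (2 * i)) * A
  + n0 / qr ^+ (2 * i) * (f (X ^+ 2 - n0) + (pr - 1) * f (X ^+ 2 - 1 - n1))
  + (pr - 1) * (n1 / qr ^+ (2 * i)) * (f (X ^+ 2 - n1) + f (X ^+ 2 - 1 - n0)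
                           + (pr - 2) * f (X ^+ 2 - 1 - n1)).
rewrite (sum_by_corank (u := u)); last first.
  move=> g i _ _ rad_i; have [-> ->] := corank_fibres rad_i.
  by rewrite rad_i natrX natrX.
have X_neq0 : X != 0 by rewrite expf_neq0.
have rad0 : #|radical 0|%:R = X ^+ 2 :> rat.
  have pm_neq0 : (p ^ m)%:R != 0 :> rat by rewrite natrX expf_neq0.
  rewrite -exp_m_rat; apply: (mulfI pm_neq0); have := expsum_sqr 0.
  rewrite expsum_zero expr2 -PoszM => -[pmE].
  by rewrite -!natrM pmE.
rewrite rad0 !qform_fibre_zero eqxx (oner_eq0 _) exp_m_rat divff ?expf_neq0 //.
rewrite subrr !subr0 -/A.
rewrite /table_L2 big_cat big_flatten big_map.
rewrite -[iota 0 4]/(index_iota 0 4) big_mkord !big_cons big_nil /= -!/(f _) pow_m pow_m1.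
pose S := \sum_(i < 4) Freq p m l i * (X ^+ 2 - X ^+ 2 / qr ^+ (2 * i)).
have -> : \sum_(i < 4) Freq p m l i * (X ^+ 2 - pr ^+ (m - 2 * i * d)) = S.
  by apply: eq_bigr => i _; rewrite pow_m2i.
have SE :
    S * A + \sum_(i < 4) (u i - (X ^+ 2 - X ^+ 2 / qr ^+ (2 * i)) * A) *+ corank_count i
    = \sum_(i < 4) u i *+ corank_count i.
  rewrite mulr_suml -big_split; apply: eq_bigr => i _ /=.
  by rewrite -[X in _ + X]mulr_natr -[RHS]mulr_natr -Freq_corank //; ring.
rewrite -SE [LHS]addrA; congr (_ + _).
  rewrite /A [X ^+ 2 - X ^+ 2 / pr - 1]addrAC.
  by field.
apply: eq_bigr => i _; rewrite !big_cons big_nil /= -!/(f _) pow_m2i pow_m2i_pred pow_hi_low.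
have e0 := entry0 i; have e1 := entry1 i; rewrite pow_m pow_m1 in e0 e1.
rewrite ![X ^+ 2 - X ^+ 2 / pr - 1 + _]addrAC e0 e1.
rewrite ![X ^+ 2 - _ - 1]addrAC -[LHS]mulr_natr -Freq_corank // /u.
rewrite (exprM qr 2) (exprAC qr 2).
move: (Freq _ _ _ _) => Fi.
move: (f (X ^+ 2 - zero_fibre i)) (f (X ^+ 2 - nonzero_fibre i))
  (f (X ^+ 2 - 1 - zero_fibre i)) (f (X ^+ 2 - 1 - nonzero_fibre i)) => y0 y1 y2 y3.
rewrite /zero_fibre /nonzero_fibre /corank_sum (exprNn qr) (exprS (-1)).
have Q_neq0 : qr ^+ i != 0 by rewrite !expf_neq0.
move: (qr ^+ i) ((-1) ^+ i) Q_neq0 => Q sg Q_neq0.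
by field; rewrite pr_neq0 Q_neq0.
Qed.

End HermitianForms.

Theorem theorem5p2 (p m l : nat) (F : finFieldType)
    (p_prime : prime p) (p_odd : odd p) (m_gt0 : (0 < m)%N) (l_gt0 : (0 < l)%N)
    (cardF : #|F| = (p ^ m)%N)
    (ml_even : ~~ odd (m %/ gcdn m l)) (m_gt6l : (6 * l < m)%N) :
  [/\ is_code (p ^ m - 1)%N (2 * m + 1)%N (dmin_L0 p m l) (code_L0 p m l F),
      is_code (p ^ m - 1)%N (3 * m + 1)%N (dmin_L2 p m l) (code_L2 p m l F),
      weight_distribution (code_L0 p m l F) (table_L0 p m l)
    & weight_distribution (code_L2 p m l F) (table_L2 p m l)].
Proof.
split.
- exact: is_code_L0.
- exact: is_code_L2.
- exact: weight_distribution_L0.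
- exact: weight_distribution_L2.
Qed.
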